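(* Let $f:[0,1]\to\mathbb{R}^d$ be a function of the form $(\ast)$ described in the context, with arbitrary $m$, $d$, $c_1,\dots,c_m$, $\lambda_1,\dots,\lambda_m$ and signature $\boldsymbol\varepsilon$. Let $s\geq 1$ be the solution of $\sum_{i=1}^m\lambda_i^s=1$. There is a unique monotone increasing function $g:[0,1]\to[0,1]$ of the form $(\ast)$ satisfying $g(0)=0$, $g(1)=1$, with $m(g)=m$, $c_i(g)=c_i$ and $\lambda_i(g)=\lambda_i^s$ for $i=1,\dots,m$, and $\boldsymbol\varepsilon(g)=\boldsymbol\varepsilon$. Define $h:[0,1]\to\mathbb{R}^d$ by $h:=f\circ g^{-1}$, where $g^{-1}(y):=\inf\{t\in[0,1]:g(t)\geq y\}$ for $0\leq y\leq 1$. Then: (a) $\tilde\alpha_g(t)=s\,\tilde\alpha_f(t)$ for all $t\in(0,1)$, so the nondirectional Hölder spectrum of $g$ is a horizontal scaling of that of $f$: $\dim_H\tilde E_g(\alpha)=\dim_H\tilde E_f(\alpha/s)$. When $c_1=\dots=c_m=1/m$ and $\boldsymbol\varepsilon=(0,0,\dots,0)$, one may replace $\tilde\alpha$ with $\alpha$ and $\tilde E$ with $E$ here, i.e. $\alpha_g(t)=s\,\alpha_f(t)$ for all $t\in(0,1)$ and $\dim_H E_g(\alpha)=\dim_H E_f(\alpha/s)$. (b) $f=h\circ g$. (c) $h$ is also of the form $(\ast)$, with $m(h)=\#\{i:\lambda_i>0\}$, $c_i(h)=\lambda_{j(i)}^s$ and $\lambda_i(h)=\lambda_{j(i)}$, where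 $j(i)$ is the index of the $i$th nonzero entry of the vector $(\lambda_1,\dots,\lambda_m)$. (d) $h$ is monofractal with constant Hölder exponent $\alpha_h(t)=1/s$ for all $t\in(0,1)$.
   Context: Functions of the form $(\ast)$. Fix integers $d\geq 1$ and $m\geq 2$, let $\mathbf{a}=(0,0,\dots,0)$ and $\mathbf{b}=(1,0,\dots,0)$ in $\mathbb{R}^d$, and fix $\boldsymbol\varepsilon=(\varepsilon_1,\dots,\varepsilon_m)\in\{0,1\}^m$ (the signature). Let $S_1,\dots,S_m$ be contractive similitudes of $\mathbb{R}^d$ with ratios $\lambda_i:=\mathrm{Lip}(S_i)$ (if $m\geq 3$, one or more of the $S_i$ may be constant, so $\lambda_i=0$), satisfying $S_1((1-\varepsilon_1)\mathbf{a}+\varepsilon_1\mathbf{b})=\mathbf{a}$, $S_m(\varepsilon_m\mathbf{a}+(1-\varepsilon_m)\mathbf{b})=\mathbf{b}$, and $S_{i-1}(\varepsilon_{i-1}\mathbf{a}+(1-\varepsilon_{i-1})\mathbf{b})=S_i((1-\varepsilon_i)\mathbf{a}+\varepsilon_i\mathbf{b})$ for $i=2,\dots,m$. Let $c_1,\dots,c_m>0$ with $\sum_{i=1}^m c_i=1$, put $\sigma_i:=\sum_{j=1}^{i-1}c_j+\varepsilon_ic_i$, $\phi_i(t):=(-1)^{\varepsilon_i}c_it+\sigma_i$, and $I_i:=\phi_i([0,1])$. Then $f:[0,1]\to\mathbb{R}^d$ is the unique continuous function satisfying $$(\ast)\qquad f(t)=S_i\big(f(\phi_i^{-1}(t))\big),\qquad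 t\in I_i,\ i=1,\dots,m.$$ To avoid degenerate cases, it is assumed throughout that $(\lambda_1,\dots,\lambda_m)\neq(c_1,\dots,c_m)$. For a function $u$ of the form $(\ast)$, the parameters $m$, $c_i$, $\lambda_i$, $\boldsymbol\varepsilon$ belonging to it are written $m(u)$, $c_i(u)$, $\lambda_i(u)$, $\boldsymbol\varepsilon(u)$; for the real-valued function $g$ the dimension $d$ is $1$. Hölder exponents. Let $u:[0,1]\to\mathbb{R}^d$. For $\alpha>0$ and $t_0\in(0,1)$, write $u\in C^\alpha(t_0)$ if there are a constant $C$ and a $d$-tuple $P=(P_1,\dots,P_d)$ of polynomials, each of degree less than $\alpha$, such that $|u(t)-P(t-t_0)|\leq C|t-t_0|^\alpha$ for all $t\in(0,1)$. The pointwise Hölder exponent of $u$ at $t$ is $\alpha_u(t):=\sup\{\alpha>0:u\in C^\alpha(t)\}$, and $E_u(\alpha):=\{t\in(0,1):\alpha_u(t)=\alpha\}$. Write $u\in\tilde C^\alpha(t_0)$ if there is a constant $C$ with $|u(t)-u(t_0)|\leq C|t-t_0|^\alpha$ for all $t\in(0,1)$. The nondirectional Hölder exponent of $u$ at $t$ is $\tilde\alpha_u(t):=\sup\{\alpha>0:u\in\tilde C^\alpha(t)\}$, and $\tilde E_u(\alpha):=\{t\in(0,1):\tilde\alpha_u(t)=\alpha\}$ for $\alpha>0$; the nondirectional Hölder spectrum of $u$ is the function $\alpha\mapsto\dim_H\tilde E_u(\alpha)$, where $\dim_H$ is Hausdorff dimension.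
   Formalization: The standing assumption (λ)≠(c) is also imposed on g in the α, E version of (a), and on h (i.e. s≠1) in (d); without it g or h can be linear with Hölder exponent +∞, and those claims fail (e.g. von Koch curve, g = identity). *)

(* Defs.v *)
From HB Require Import structures.
From mathcomp Require Import all_boot all_order all_algebra.
From mathcomp Require Import all_classical all_reals all_analysis.

Set Implicit Arguments.
Unset Strict Implicit.
Unset Printing Implicit Defensive.

Import Order.TTheory GRing.Theory Num.Theory.
Import numFieldNormedType.Exports.

Local Open Scope classical_set_scope.
Local Open Scope ring_scope.

(* The library norm on 'rV[R]_d is the max norm; similitudes need the Euclidean
   one. *)
Definition enorm (R : realType) (d : nat) (x : 'rV[R]_d) : R :=
  Num.sqrt (\sum_(i < d) x ord0 i ^+ 2).

(* A real-valued function seen as an R^1-valued one. *)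
Definition vec1 (R : realType) (u : R -> R) : R -> 'rV[R]_1 :=
  fun t => const_mx (u t).

Section FormStar.
Variable R : realType.

Definition pt_a (d : nat) : 'rV[R]_d := 0.
Definition pt_b (d : nat) : 'rV[R]_d := \row_(j < d) (j == 0%N :> nat)%:R.

Definition pt_in (d : nat) (e : bool) : 'rV[R]_d :=
  (1 - e%:R) *: pt_a d + e%:R *: pt_b d.
Definition pt_out (d : nat) (e : bool) : 'rV[R]_d :=
  e%:R *: pt_a d + (1 - e%:R) *: pt_b d.

(* The ratio 0 is allowed: S is then constant. *)
Definition contractive_similitude (d : nat) (r : R) (S : 'rV[R]_d -> 'rV[R]_d) :=
  0 <= r < 1 /\ forall x y, enorm (S x - S y) = r * enorm (x - y).

Section Partition.
Variables (m : nat) (c : 'I_m -> R) (eps : 'I_m -> bool).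

Definition sigma (i : 'I_m) : R := \sum_(j < m | (j < i)%N) c j + (eps i)%:R * c i.
Definition phi (i : 'I_m) (t : R) : R := (-1) ^+ eps i * c i * t + sigma i.
Definition phi_inv (i : 'I_m) (t : R) : R := (t - sigma i) / ((-1) ^+ eps i * c i).
Definition piece (i : 'I_m) : set R := phi i @` `[0, 1].

End Partition.

(* Indices run over 0, ..., m-1.  A function on [0,1] is represented by any
   f : R -> R^d; its values outside [0,1] play no role. *)
Record of_form_star_with (d m : nat) (c lam : 'I_m -> R) (eps : 'I_m -> bool)
    (S : 'I_m -> 'rV[R]_d -> 'rV[R]_d) (f : R -> 'rV[R]_d) : Prop := {
  fs_dim : (1 <= d)%N;
  fs_num : (2 <= m)%N;
  fs_simil : forall i, contractive_similitude (lam i) (S i);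
  fs_first : forall i : 'I_m, i = 0%N :> nat -> S i (pt_in d (eps i)) = pt_a d;
  fs_last : forall i : 'I_m, i.+1 = m -> S i (pt_out d (eps i)) = pt_b d;
  fs_chain : forall i j : 'I_m, j = i.+1 :> nat ->
    S i (pt_out d (eps i)) = S j (pt_in d (eps j));
  fs_c_gt0 : forall i, 0 < c i;
  fs_c_sum : \sum_i c i = 1;
  fs_cont : {within `[0, 1], continuous f};
  fs_eqn : forall (i : 'I_m) (t : R), piece c eps i t -> f t = S i (f (phi_inv c eps i t)) }.

Definition of_form_star (d m : nat) (c lam : 'I_m -> R) (eps : 'I_m -> bool)
    (f : R -> 'rV[R]_d) : Prop :=
  exists S : 'I_m -> 'rV[R]_d -> 'rV[R]_d, of_form_star_with c lam eps S f.

(* Kept apart from of_form_star: a degenerate f is the straight line t |-> t b,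
   whose pointwise Hölder exponent is +oo. *)
Definition nondegenerate_params (m : nat) (c lam : 'I_m -> R) : Prop := ~ (lam =1 c).

End FormStar.

Section Hoelder.
Variables (R : realType) (d : nat).
Implicit Types (u : R -> 'rV[R]_d).

(* (size p).-1 is the degree of p, with degree 0 for p = 0. *)
Definition holder_at u (alpha t0 : R) : Prop :=
  exists (C : R) (P : 'I_d -> {poly R}),
    (forall i, (size (P i)).-1%:R < alpha) /\
    forall t : R, 0 < t < 1 ->
      enorm (u t - \row_(i < d) (P i).[t - t0]) <= C * `|t - t0| `^ alpha.

Definition nd_holder_at u (alpha t0 : R) : Prop :=
  exists C : R, forall t : R, 0 < t < 1 ->
    enorm (u t - u t0) <= C * `|t - t0| `^ alpha.

Definition holder_exponent u (t : R) : \bar R :=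
  ereal_sup [set alpha%:E | alpha in [set alpha : R | 0 < alpha /\ holder_at u alpha t]].

Definition nd_holder_exponent u (t : R) : \bar R :=
  ereal_sup [set alpha%:E | alpha in [set alpha : R | 0 < alpha /\ nd_holder_at u alpha t]].

Definition holder_level u (alpha : R) : set R :=
  [set t | 0 < t < 1 /\ holder_exponent u t = alpha%:E].

Definition nd_holder_level u (alpha : R) : set R :=
  [set t | 0 < t < 1 /\ nd_holder_exponent u t = alpha%:E].

End Hoelder.

Section Hausdorff.
Variable R : realType.
Local Open Scope ereal_scope.

Definition diam (U : set R) : \bar R :=
  ereal_sup [set `|xy.1 - xy.2|%R%:E | xy in U `*` U].

(* diam set0 = -oo, and 0 `^ 0 = 1: the empty set must be given cost 0. *)
Definition hausdorff_cost (delta : R) (U : set R) : \bar R :=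
  if U == set0 then 0 else diam U `^ delta.

Definition hausdorff_premeasure (delta eta : R) (A : set R) : \bar R :=
  ereal_inf [set \sum_(0 <= k <oo) hausdorff_cost delta (U k) |
    U in [set U : (set R)^nat |
      (forall k, diam (U k) <= eta%:E) /\ A `<=` \bigcup_k U k]].

Definition hausdorff_measure (delta : R) (A : set R) : \bar R :=
  ereal_sup [set hausdorff_premeasure delta eta A | eta in [set eta : R | (0 < eta)%R]].

Definition hausdorff_dim (A : set R) : \bar R :=
  ereal_inf [set delta%:E |
    delta in [set delta : R | (0 <= delta)%R /\ hausdorff_measure delta A = 0]].

End Hausdorff.

(* The distribution-like inverse of a nondecreasing g : [0,1] -> [0,1]. *)
Definition left_inv (R : realType) (g : R -> R) (y : R) : R :=
  inf [set t | 0 <= t <= 1 /\ y <= g t].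

Definition is_time_change (R : realType) (m : nat) (c lam : 'I_m -> R)
    (eps : 'I_m -> bool) (s : R) (g : R -> R) : Prop :=
  [/\ forall t : R, 0 <= t <= 1 -> 0 <= g t <= 1,
      forall t t' : R, 0 <= t -> t <= t' -> t' <= 1 -> g t <= g t',
      g 0 = 0, g 1 = 1 &
      of_form_star c (fun i => lam i `^ s) eps (vec1 g)].

(* enum_val lists the elements of a set of ordinals in increasing order, so this
   is the index of the i-th nonzero entry of lam. *)
Definition nonzero_index (R : realType) (m : nat) (lam : 'I_m -> R)
    (i : 'I_#|[pred k : 'I_m | 0 < lam k]|) : 'I_m :=
  enum_val i.

(* Main.v *)
(* The map f satisfies |f (phi_i x) - f (phi_i y)| = lam_i |f x - f y|, so its oscillation
   over an interval is subadditive and is multiplied by lam_i when the interval is moved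
   into the i-th piece.  The quantity (g u - g t)^(1/s) has the same two properties, and
   any two such interval functions are comparable: descend to the first generation that
   separates t from u, and then along one endpoint.  Hence osc f [t, u] is of the exact
   order (g u - g t)^(1/s), which gives the relation between the nondirectional exponents,
   the factorization through g, and the exponent 1/s of h.  For polynomial-corrected
   exponents in the uniform case, a nontrivial Taylor term a (t - t0)^k could be zoomed
   along the m-adic intervals around t0, forcing |f x - f y| to be proportional to
   |(x - z)^k - (y - z)^k|; self-affinity then leaves only k = 1 and lam = c. *)

Require Import Defs.
From mathcomp Require Import all_boot all_order all_algebra.
From mathcomp Require Import all_classical all_reals all_analysis.
From mathcomp Require Import ring lra.
Import Order.TTheory GRing.Theory Num.Theory.
Import numFieldNormedType.Exports.
Local Open Scope classical_set_scope.
Local Open Scope ring_scope.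

Set Implicit Arguments.
Unset Strict Implicit.
Unset Printing Implicit Defensive.

(** * Euclidean norm *)

Section EuclideanNorm.
Variables (R : realType) (d : nat).
Implicit Types x y z : 'rV[R]_d.

(** Two features shape the comparison of interval functions. Ratios may vanish, so a nontrivial
    interval can have size zero, and both sizes must then vanish together: runs of cells of ratio 0
    are discarded by subadditivity before rescaling. Moreover the descent need not stop, so each
    estimate is proved at depth n with a geometric error, and n is sent to infinity. Orientation
    reversal is confined to the reflection [flip]; every argument then runs over cells in increasing
    order, both for the partition of the domain with lengths c_i and for the partition of the range
    with lengths lam_i^s, some of them zero. In the Taylor argument the position z of t0 inside its
    cylinder changes with the depth, so only approximate identities are available; compactness
    supplies one exact z. For k >= 2, exact scaling of |(x - z)^k - (y - z)^k| forces z to be fixed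
    by every [phi c eps i], which is impossible because the first and the last of these maps have
    different fixed points. *)

Lemma enorm_ge0 x : 0 <= enorm x.
Proof. exact: sqrtr_ge0. Qed.

Lemma sqr_enorm x : enorm x ^+ 2 = \sum_(i < d) x ord0 i ^+ 2.
Proof. by rewrite sqr_sqrtr // sumr_ge0 // => i _; exact: sqr_ge0. Qed.

Lemma enormZ (a : R) x : enorm (a *: x) = `|a| * enorm x.
Proof.
rewrite /enorm -sqrtr_sqr -sqrtrM ?sqr_ge0 // mulr_sumr; congr Num.sqrt.
by apply: eq_bigr => i _; rewrite mxE exprMn.
Qed.

Lemma enormN x : enorm (- x) = enorm x.
Proof. by rewrite -scaleN1r enormZ normrN1 mul1r. Qed.

Lemma enormB x y : enorm (x - y) = enorm (y - x).
Proof. by rewrite -enormN opprB. Qed.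

Lemma enorm0 : enorm (0 : 'rV[R]_d) = 0.
Proof. by rewrite -(scale0r 0) enormZ normr0 mul0r. Qed.

Lemma coord_le_enorm x i : `|x ord0 i| <= enorm x.
Proof.
rewrite -sqrtr_sqr /enorm ler_sqrt; last by rewrite sumr_ge0 // => j _; exact: sqr_ge0.
by rewrite (bigD1 i) //= lerDl sumr_ge0 // => j _; exact: sqr_ge0.
Qed.

Lemma enorm_eq0 x : enorm x = 0 -> x = 0.
Proof.
move=> x0; apply/rowP => i; rewrite mxE; apply/eqP; rewrite -normr_le0 -x0.
exact: coord_le_enorm.
Qed.

Lemma enormB_eq0 x y : enorm (x - y) = 0 -> x = y.
Proof. by move=> /enorm_eq0 /eqP; rewrite subr_eq0 => /eqP. Qed.

(** Termwise arithmetic-geometric means: after dividing by the two norms, each difference of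
    summands is a positive multiple of a square. *)
Lemma dot_le_enorm x y : \sum_(i < d) x ord0 i * y ord0 i <= enorm x * enorm y.
Proof.
have [x0|x0] := eqVneq (enorm x) 0.
  rewrite x0 mul0r big1 // => i _.
  by rewrite (enorm_eq0 x0) mxE mul0r.
have [y0|y0] := eqVneq (enorm y) 0.
  rewrite y0 mulr0 big1 // => i _.
  by rewrite (enorm_eq0 y0) mxE mulr0.
have X0 : 0 < enorm x by rewrite lt0r x0 enorm_ge0.
have Y0 : 0 < enorm y by rewrite lt0r y0 enorm_ge0.
set X := enorm x in x0 X0 *; set Y := enorm y in y0 Y0 *.
have -> : X * Y = \sum_(i < d) 2^-1 * (Y / X * x ord0 i ^+ 2 + X / Y * y ord0 i ^+ 2).
  rewrite -mulr_sumr big_split /= -!mulr_sumr -!sqr_enorm -/X -/Y.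
  by field; apply/andP.
apply: ler_sum => i _; rewrite -subr_ge0.
set a := x ord0 i; set b := y ord0 i.
have -> : 2^-1 * (Y / X * a ^+ 2 + X / Y * b ^+ 2) - a * b =
  2^-1 * (X * Y) * (a / X - b / Y) ^+ 2 by field; apply/andP.
by rewrite mulr_ge0 ?sqr_ge0 // mulr_ge0 ?invr_ge0 ?ler0n // ltW // mulr_gt0.
Qed.

Lemma ler_enormD x y : enorm (x + y) <= enorm x + enorm y.
Proof.
rewrite -(@ler_pXn2r _ 2) ?nnegrE ?enorm_ge0 ?addr_ge0 ?enorm_ge0 //.
rewrite sqrrD !sqr_enorm.
under eq_bigr do rewrite mxE sqrrD.
rewrite !big_split /= lerD2r lerD2l.
by rewrite mulr2n lerD // dot_le_enorm.
Qed.

Lemma ler_enorm_dist z x y : enorm (x - y) <= enorm (x - z) + enorm (z - y).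
Proof. by rewrite -{1}(subrKA z x (- y)) ler_enormD. Qed.

Lemma ler_dist_enorm x y : `|enorm x - enorm y| <= enorm (x - y).
Proof.
have h (u v : 'rV[R]_d) : enorm u - enorm v <= enorm (u - v).
  by rewrite lerBlDr -{1}(subrK v u) ler_enormD.
by rewrite ler_norml h andbT lerNl opprB enormB h.
Qed.

Lemma enorm_le_mx_norm x : enorm x <= d%:R * `|x|.
Proof.
rewrite -(@ler_pXn2r _ 2) ?nnegrE ?enorm_ge0 ?mulr_ge0 // sqr_enorm.
apply: (@le_trans _ _ (\sum_(i < d) `|x| ^+ 2)).
  apply: ler_sum => i _; rewrite -(real_normK (num_real _)) ler_pXn2r ?nnegrE //.
  by rewrite [leRHS]mx_normrE; exact: (le_bigmax _ (fun ij => `|x ij.1 ij.2|) (ord0, i)).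
rewrite sumr_const card_ord exprMn -[leLHS]mulr_natl.
rewrite ler_wpM2r ?sqr_ge0 //.
by rewrite -natrX ler_nat; case: d => // n; rewrite leq_pmulr.
Qed.

Lemma mx_norm_le_enorm x : `|x| <= enorm x.
Proof.
rewrite [leLHS]mx_normrE; apply: bigmax_le => [|[i j] _]; first exact: enorm_ge0.
by rewrite /= ord1 coord_le_enorm.
Qed.

End EuclideanNorm.

Lemma enorm_rV1 (R : realType) (x : 'rV[R]_1) : enorm x = `|x ord0 ord0|.
Proof. by rewrite /enorm big_ord1 sqrtr_sqr. Qed.

Lemma enorm_vec1 (R : realType) (u : R -> R) (t t' : R) :
  enorm (vec1 u t - vec1 u t') = `|u t - u t'|.
Proof. by rewrite enorm_rV1 !mxE. Qed.

Lemma enorm_pt_b (R : realType) (d : nat) : (0 < d)%N -> enorm (pt_b R d - pt_a R d) = 1.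
Proof.
case: d => // d _; rewrite /enorm (bigD1 ord0) //= !mxE big1 ?addr0 => [|i i0].
  by rewrite subr0 expr1n sqrtr1.
by rewrite !mxE subr0 (_ : (i == 0%N :> nat) = false) ?expr0n //; apply/negbTE.
Qed.

(** * Partitions of the unit interval *)

Section Partition.
Variables (R : realType) (m : nat).
Implicit Types (c : 'I_m -> R) (eps : 'I_m -> bool).

(** Separates orientation from position: [phi c eps i] is [flip (eps i)] followed by the increasing
    affine map onto the i-th cell. *)
Definition flip (e : bool) (x : R) : R := if e then 1 - x else x.

Lemma flipK e : involutive (flip e).
Proof. by case: e => x //=; rewrite /flip; ring. Qed.

Lemma flip_itv e x : 0 <= x <= 1 -> 0 <= flip e x <= 1.
Proof. by case: e => //=; lra. Qed.

Lemma flip_dist e x y : `|flip e x - flip e y| = `|x - y|.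
Proof. by case: e => //=; rewrite opprB addrC addrA subrK distrC. Qed.

(** The division points, indexed by [nat] so that the right end of the last cell is [knot c m]. The
    same function serves the partition of the domain and the partition of the range, whose cells may
    be degenerate. *)
Definition knot c (k : nat) : R := \sum_(j < m | (j < k)%N) c j.

Lemma knot0 c : knot c 0 = 0.
Proof. by rewrite /knot big_pred0. Qed.

Lemma knot_max c : knot c m = \sum_j c j.
Proof. by apply: eq_bigl => j; rewrite ltn_ord. Qed.

Lemma knotS c (i : 'I_m) : knot c i.+1 = knot c i + c i.
Proof.
rewrite /knot (bigD1 i) /= ?ltnSn // addrC; congr (_ + _).
by apply: eq_bigl => j; rewrite ltnS ltn_neqAle andbC.
Qed.

Lemma ler_knot c (k l : nat) : (forall i, 0 <= c i) -> (k <= l)%N -> knot c k <= knot c l.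
Proof.
move=> c0 kl; rewrite /knot big_mkcond [leRHS]big_mkcond /=; apply: ler_sum => j _.
by case: ifP => [/leq_trans->//|_]; case: ifP.
Qed.

Lemma phiE c eps i t : phi c eps i t = knot c i + c i * flip (eps i) t.
Proof.
rewrite /phi /sigma -/(knot c i) /flip; case: (eps i) => /=.
  by rewrite expr1; ring.
by rewrite expr0; ring.
Qed.

Lemma phi_flip c eps i x : phi c eps i (flip (eps i) x) = knot c i + c i * x.
Proof. by rewrite phiE flipK. Qed.

Lemma phiK c eps i t : c i != 0 -> phi_inv c eps i (phi c eps i t) = t.
Proof. by move=> c0; rewrite /phi_inv /phi; case: (eps i) => /=; field; rewrite ?c0. Qed.

Lemma phi_piece c eps i t : 0 <= t <= 1 -> piece c eps i (phi c eps i t).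
Proof. by move=> t01; exists t => //=; rewrite in_itv. Qed.

Lemma pieceP c eps i t :
  piece c eps i t -> exists2 x, 0 <= x <= 1 & t = phi c eps i x.
Proof. by case=> x /=; rewrite in_itv /= => x01 <-; exists x. Qed.

Lemma knot_itv c (k : nat) : (forall i, 0 <= c i) -> \sum_i c i = 1 -> 0 <= knot c k <= 1.
Proof.
move=> c0 c1; rewrite /knot sumr_ge0 //= -c1 [leRHS](bigID (fun j : 'I_m => (j < k)%N)) /=.
by rewrite lerDl sumr_ge0.
Qed.

Lemma sub_knot_itv c (i : 'I_m) x : (forall i, 0 <= c i) -> \sum_i c i = 1 ->
  0 <= x <= 1 -> knot c i <= knot c i + c i * x <= knot c i.+1.
Proof. by move=> c0 c1 /andP[x0 x1]; rewrite knotS lerDl lerD2l ler_piMr // mulr_ge0. Qed.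

Lemma phi_itv c eps i t : (forall i, 0 <= c i) -> \sum_i c i = 1 ->
  0 <= t <= 1 -> 0 <= phi c eps i t <= 1.
Proof.
move=> c0 c1 t01; rewrite phiE.
have /andP[h1 h2] := sub_knot_itv i c0 c1 (flip_itv (eps i) t01).
have /andP[a0 _] := knot_itv i c0 c1.
have /andP[_ b1] := knot_itv i.+1 c0 c1.
by rewrite (le_trans a0 h1) (le_trans h2 b1).
Qed.

Section Positive.
Variables (c : 'I_m -> R).
Hypotheses (c_gt0 : forall i, 0 < c i) (c_sum : \sum_i c i = 1).

Let c_ge0 i : 0 <= c i. Proof. exact: ltW. Qed.

Lemma num_pieces_gt0 : (0 < m)%N.
Proof.
case: m c c_sum => // c' /eqP; rewrite big_ord0 eq_sym oner_eq0 //.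
Qed.

Lemma knot_ord_lt (i : 'I_m) (k l : nat) : (k <= i)%N -> (i < l)%N -> knot c k < knot c l.
Proof.
move=> ki il; apply: (le_lt_trans (ler_knot c_ge0 ki)).
by apply: lt_le_trans (ler_knot c_ge0 il); rewrite knotS ltrDl.
Qed.

Lemma cell_exists t : 0 <= t <= 1 ->
  exists i : 'I_m, exists2 x, 0 <= x <= 1 & t = knot c i + c i * x.
Proof.
move=> /andP[t0 t1].
have [k tk ] : exists k : 'I_m, knot c k <= t <= knot c k.+1.
  (* Search downwards from the last division point for the first one to the right of t. *)
  suff: forall k, (k <= m)%N -> t <= knot c k -> (0 < k)%N ->
      exists k : 'I_m, knot c k <= t <= knot c k.+1.
    by apply; [exact: leqnn | rewrite knot_max c_sum | exact: num_pieces_gt0].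
  elim=> // k IH km tk _.
  have [tk'|tk'] := lerP t (knot c k); last first.
    by exists (Ordinal km); rewrite (ltW tk').
  case: k IH km tk tk' => [|k] IH km tk tk'; last by apply: IH => //; exact: ltnW.
  exists (Ordinal km) => /=; rewrite tk andbT; by rewrite knot0.
have /andP[h1 h2] := tk; exists k, ((t - knot c k) / c k).
  rewrite divr_ge0 ?subr_ge0 //= ler_pdivrMr ?c_gt0 // mul1r lerBlDl.
  by rewrite -knotS.
by rewrite mulrC divfK ?subrKC // gt_eqF.
Qed.

Lemma cell_pair t u : 0 <= t -> t <= u -> u <= 1 ->
  (exists i : 'I_m, exists x y, [/\ 0 <= x, x <= y, y <= 1,
     t = knot c i + c i * x & u = knot c i + c i * y]) \/
  (exists i j : 'I_m, exists x y, [/\ (i < j)%N, 0 <= x <= 1, 0 <= y <= 1,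
     t = knot c i + c i * x & u = knot c j + c j * y]).
Proof.
move=> t0 tu u1.
have [|i [x x01 tE]] := @cell_exists t; first by rewrite t0 (le_trans tu).
have [|j [y y01 uE]] := @cell_exists u; first by rewrite u1 (le_trans t0).
have /andP[hi1 hi2] := sub_knot_itv i c_ge0 c_sum x01.
have /andP[hj1 hj2] := sub_knot_itv j c_ge0 c_sum y01.
case: (ltngtP i j) => ij.
- by right; exists i, j, x, y.
(* Here j < i although t <= u, which forces t = u at a common division point; the first alternative
   holds with x = y. *)
- left; exists i, x, x.
  have h : knot c j.+1 <= knot c i by exact: ler_knot.
  have /andP[x0 x1] := x01.
  split => //; apply/le_anti; rewrite -tE tu andbT.
  by rewrite tE uE (le_trans hj2) // (le_trans h).
- left; exists i, x, y.
  have ? : i = j by exact: val_inj.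
  subst j; have /andP[x0 x1] := x01; have /andP[y0 y1] := y01; split => //.
  by move: tu; rewrite tE uE lerD2l ler_pM2l.
Qed.

Lemma phi_exists eps t : 0 <= t <= 1 ->
  exists i, exists2 x, 0 <= x <= 1 & t = phi c eps i x.
Proof.
move=> /cell_exists [i [x x01 ->]]; exists i, (flip (eps i) x); first exact: flip_itv.
by rewrite phi_flip.
Qed.

End Positive.
End Partition.

(** * Comparison of self-affine interval functions *)

Section Limits.
Variable R : realType.
Implicit Types a b r K : R.

Lemma geometric_small r K (e : R) : 0 <= r < 1 -> 0 < e -> exists n, K * r ^+ n < e.
Proof.
move=> /andP[r0 r1] e0.
have : (fun n => K * r ^+ n) @ \oo --> K * 0.
  by apply: cvgMr; apply: cvg_expr; rewrite ger0_norm.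
rewrite mulr0 => /cvgrPdist_lt /(_ _ e0) [N _ /(_ N (leqnn N))] /=.
by rewrite sub0r normrN => h; exists N; rewrite (le_lt_trans (ler_norm _)).
Qed.

Lemma le_of_geometric_error r K a b :
  0 <= r < 1 -> (forall n, a <= b + K * r ^+ n) -> a <= b.
Proof.
move=> r01 h; rewrite leNgt; apply/negP => ba.
have [n hn] := @geometric_small r K (a - b) r01 (ltac:(by rewrite subr_gt0)).
by have := le_lt_trans (h n) (ltac:(rewrite -ltrBrDl; exact: hn)); rewrite ltxx.
Qed.

Lemma geometric_limit r (v : nat -> R) : 0 <= r < 1 ->
  (forall n, `|v n.+1 - v n| <= r ^+ n) ->
  exists l, forall n, `|l - v n| <= (1 - r)^-1 * r ^+ n.
Proof.
move=> /andP[r0 r1] hv; set K := (1 - r)^-1.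
have K0 : 0 < K by rewrite invr_gt0 subr_gt0.
(* [K] is the sum of the geometric series; this identity makes the intervals of radius [K * r ^+ n]
   around [v n] nested. *)
have KE : K = 1 + K * r by rewrite /K; field; rewrite subr_eq0 gt_eqF.
have Kr n : K * r ^+ n = r ^+ n + K * r ^+ n.+1 by rewrite {1}KE exprS; ring.
pose a n := v n - K * r ^+ n; pose b n := v n + K * r ^+ n.
have aS n : a n <= a n.+1.
  by have := hv n; rewrite /a Kr ler_norml => /andP[]; lra.
have bS n : b n.+1 <= b n.
  by have := hv n; rewrite /b (Kr n) ler_norml => /andP[]; lra.
have am i n : (i <= n)%N -> a i <= a n by exact: (homo_leq (@lexx _ _) le_trans aS).
have bm i n : (i <= n)%N -> b n <= b i.
  by move=> /(homo_leq (r := fun x y => y <= x) (@lexx _ _) (fun _ _ _ h1 h2 => le_trans h2 h1) bS).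
have ab n : a n <= b n.
  by rewrite /a /b lerD2l (@le_trans _ _ 0) ?oppr_le0 ?mulr_ge0 ?exprn_ge0 ?(ltW K0).
have abk i n : a i <= b n.
  case: (leqP i n) => h; first exact: le_trans (am _ _ h) (ab n).
  exact: le_trans (ab i) (bm _ _ (ltnW h)).
exists (sup [set a n | n in setT]) => n.
have h1 : a n <= sup [set a n | n in setT].
  by apply: ub_le_sup; [exists (b 0%N) => _ [k _ <-]; exact: abk | exists n].
have h2 : sup [set a n | n in setT] <= b n.
  by apply: ge_sup => [|_ [k _ <-]]; [exists (a 0%N), 0%N | exact: abk].
by move: h1 h2; rewrite /a /b ler_norml => h1 h2; apply/andP; split; lra.
Qed.

(** Each summand is a share q of a + b with 0 <= q <= 1, and q <= q^p for p <= 1; the two shares add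
    up to 1. *)
Lemma powR_subadditive (p a b : R) : 0 < p <= 1 -> 0 <= a -> 0 <= b ->
  (a + b) `^ p <= a `^ p + b `^ p.
Proof.
move=> /andP[p0 p1] a0 b0.
have [s0|s0] := eqVneq (a + b) 0.
  by rewrite s0 powR0 ?gt_eqF // addr_ge0 ?powR_ge0.
have S0 : 0 < a + b by rewrite lt0r s0 addr_ge0.
have h (x : R) : 0 <= x -> x <= a + b -> x / (a + b) * (a + b) `^ p <= x `^ p.
  move=> x0 xs; rewrite le_eqVlt in x0; case/orP: x0 => [/eqP <-|x0].
    by rewrite !mul0r powR_ge0.
  have q01 : 0 < x / (a + b) <= 1 by rewrite divr_gt0 //= ler_pdivrMr // mul1r.
  rewrite -[in leRHS](divfK s0 x) powRM ?(ltW S0) ?(ltW (proj1 (andP q01))) //.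
  by rewrite ler_wpM2r ?powR_ge0 // ger1_powR.
apply: le_trans (lerD (h a a0 _) (h b b0 _)); rewrite ?lerDl ?lerDr //.
by rewrite -mulrDl -mulrDl divff // mul1r.
Qed.

Lemma finite_ratio_bound (m : nat) (lam : 'I_m -> R) : (forall i, 0 <= lam i < 1) ->
  exists2 r, 0 <= r < 1 & forall i, lam i <= r.
Proof.
move=> lam01; exists (\big[Num.max/0]_i lam i).
  rewrite bigmax_ge_id /=; apply/bigmax_ltP; split => // i _.
  by case/andP: (lam01 i).
by move=> i; exact: le_bigmax.
Qed.

Lemma finite_positive_bound (m : nat) (lam : 'I_m -> R) :
  exists2 k, 0 < k <= 1 & forall i, 0 < lam i -> k <= lam i.
Proof.
exists (\big[Num.min/1]_(i | 0 < lam i) lam i).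
  by rewrite bigmin_le_id andbT; apply/bigmin_gtP; split.
by move=> i li; exact: bigmin_le_cond.
Qed.

End Limits.

Section Gauge.
Variables (R : realType) (m : nat) (c lam : 'I_m -> R) (eps : 'I_m -> bool).
Hypotheses (c_gt0 : forall i, 0 < c i) (c_sum : \sum_i c i = 1).
Hypothesis lam01 : forall i, 0 <= lam i < 1.

(* A size of subintervals [t, u] of [0, 1] that behaves like the oscillation of
   a self-affine function. *)
Record gauge (A : R -> R -> R) : Prop := Gauge {
  gauge_refl : forall t, A t t = 0;
  gauge_full : 0 < A 0 1;
  gauge_mono : forall t t' u' u : R, 0 <= t -> t <= t' -> t' <= u' -> u' <= u -> u <= 1 ->
    A t' u' <= A t u;
  gauge_subadd : forall t u v : R, 0 <= t -> t <= u -> u <= v -> v <= 1 ->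
    A t v <= A t u + A u v;
  gauge_scale : forall (i : 'I_m) (x y : R), 0 <= x -> x <= y -> y <= 1 ->
    A (knot c i + c i * x) (knot c i + c i * y) =
    lam i * (if eps i then A (1 - y) (1 - x) else A x y) }.

Let c_ge0 i : 0 <= c i. Proof. exact: ltW. Qed.
Let knot_ge0 k : 0 <= knot c k. Proof. by case/andP: (knot_itv k c_ge0 c_sum). Qed.
Let knot_le1 k : knot c k <= 1. Proof. by case/andP: (knot_itv k c_ge0 c_sum). Qed.
Let knot_le k l : (k <= l)%N -> knot c k <= knot c l. Proof. exact: ler_knot. Qed.
Let lam_ge0 i : 0 <= lam i. Proof. by case/andP: (lam01 i). Qed.

Lemma gauge_ge0 A t u : gauge A -> 0 <= t -> t <= u -> u <= 1 -> 0 <= A t u.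
Proof. by move=> gA t0 tu u1; rewrite -(gauge_refl gA t); exact: gauge_mono. Qed.

Lemma gauge_left A (i : 'I_m) y : gauge A -> 0 <= y <= 1 ->
  A (knot c i) (knot c i + c i * y) = lam i * (if eps i then A (1 - y) 1 else A 0 y).
Proof.
move=> gA /andP[y0 y1]; rewrite -[X in A X _]addr0 -[X in A (_ + X) _](mulr0 (c i)).
by rewrite (gauge_scale gA) // subr0.
Qed.

Lemma gauge_right A (i : 'I_m) y : gauge A -> 0 <= y <= 1 ->
  A (knot c i + c i * y) (knot c i.+1) = lam i * (if eps i then A 0 (1 - y) else A y 1).
Proof.
move=> gA /andP[y0 y1]; rewrite knotS -[X in A _ (_ + X)]mulr1.
by rewrite (gauge_scale gA) // subrr.
Qed.

Lemma gauge_cell A (i : 'I_m) : gauge A -> A (knot c i) (knot c i.+1) = lam i * A 0 1.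
Proof.
move=> gA; rewrite knotS -[X in A _ (_ + X)]mulr1 gauge_left ?ler01 ?lexx //.
by rewrite subrr if_same.
Qed.

Lemma gauge_dead A (a b : nat) : gauge A -> (a <= b <= m)%N ->
  (forall k : 'I_m, (a <= k < b)%N -> lam k = 0) -> A (knot c a) (knot c b) = 0.
Proof.
move=> gA; elim: b => [|b IH] /andP[ab bm] dead.
  by move: ab; rewrite leqn0 => /eqP ->; rewrite gauge_refl.
move: ab; rewrite leq_eqVlt => /orP[/eqP ->|ab]; first by rewrite gauge_refl.
apply/le_anti/andP; split; last by apply: gauge_ge0 => //; exact/knot_le/ltnW.
rewrite ltnS in ab.
apply: (@le_trans _ _ (A (knot c a) (knot c b) + A (knot c b) (knot c b.+1))).
  by apply: gauge_subadd; rewrite ?knot_le.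
rewrite IH ?ab ?(ltnW bm) // => [|k /andP[ak kb]]; last by rewrite dead // ak ltnW.
by rewrite add0r (gauge_cell (Ordinal bm)) // dead ?mul0r //= ab leqnn.
Qed.

Lemma gauge_comparison A B : gauge A -> gauge B ->
  exists2 K, 0 < K & forall t u, 0 <= t -> t <= u -> u <= 1 -> A t u <= K * B t u.
Proof.
move=> gA gB.
have [r /andP[r0 r1] lamr] := finite_ratio_bound lam01.
have [k /andP[k0 _] lamk] := finite_positive_bound lam.
set D := A 0 1; set E := B 0 1.
have D0 : 0 < D := gauge_full gA.
have E0 : 0 < E := gauge_full gB.
(* A cell of positive ratio has [B]-size at least [k * E], while no interval has [A]-size above
   [D]. *)
set K1 := D / (k * E).
have K10 : 0 < K1 by rewrite divr_gt0 // mulr_gt0.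
have A_le a b : 0 <= a -> a <= b -> b <= 1 -> A a b <= D.
  by move=> a0 ab b1; exact: gauge_mono.
have big_cell (i : 'I_m) t u : 0 <= t -> t <= knot c i -> knot c i.+1 <= u -> u <= 1 ->
    0 < lam i -> D <= K1 * B t u.
  move=> t0 ti iu u1 li; apply: (@le_trans _ _ (K1 * B (knot c i) (knot c i.+1))).
    rewrite gauge_cell // -/E (_ : K1 * _ = D * (lam i / k)); last first.
      by rewrite /K1; field; rewrite !gt_eqF.
    by rewrite ler_pMr // ler_pdivlMr // mul1r lamk.
  by rewrite ler_pM2l //; apply: gauge_mono; rewrite ?knot_le.
clearbody K1.
have err_mono n (i : 'I_m) a b : a <= K1 * b + D * r ^+ n ->
    lam i * a <= K1 * (lam i * b) + D * r ^+ n.+1.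
  move=> /(ler_wpM2l (lam_ge0 i)) /le_trans -> //.
  rewrite mulrDr mulrCA lerD2l mulrCA ler_pM2l // exprS ler_wpM2r ?exprn_ge0 //.
have err0 n : 0 <= D * r ^+ n by rewrite mulr_ge0 ?exprn_ge0 // ltW.
(* Near an endpoint of a cell either a whole cell of positive ratio is covered, and
   big_cell applies, or the leading cells have ratio 0 and both sides are rescaled by the
   same ratio; iterating n times leaves the error D * r ^+ n. *)
have one_sided n x : 0 <= x <= 1 ->
    A 0 x <= K1 * B 0 x + D * r ^+ n /\ A x 1 <= K1 * B x 1 + D * r ^+ n.
  elim: n x => [|n IH] x x01.
    have /andP[x0 x1] := x01.
    by rewrite expr0 mulr1; split; rewrite -[leLHS]add0r lerD ?mulr_ge0 ?(ltW K10) ?gauge_ge0 ?A_le //.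
  have [i [y y01 xE]] := cell_exists c_gt0 c_sum x01.
  have /andP[ix xi] : knot c i <= x <= knot c i.+1 by rewrite xE sub_knot_itv.
  have /andP[x0 x1] := x01.
  have /andP[y0 y1] := y01.
  have [IH0 IH1] := IH _ y01.
  have [IH0' IH1'] := IH _ (flip_itv true y01).
  have i_m : (i <= m)%N by exact: ltnW.
  have aliveP (a b : nat) : (exists2 j : 'I_m, (a <= j < b)%N & 0 < lam j) \/
      (forall j : 'I_m, (a <= j < b)%N -> lam j = 0).
    have [[j]|h] := pselect (exists2 j : 'I_m, (a <= j < b)%N & 0 < lam j); first by left; exists j.
    right => j jab; apply/eqP; rewrite eq_le lam_ge0 andbT leNgt; apply/negP => lj.
    by apply: h; exists j.
  split.
    have [[j /andP[_ ji] lj]|dead] := aliveP 0%N i.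
      apply: (@le_trans _ _ D); first exact: gauge_mono.
      by rewrite (le_trans (big_cell j 0 x _ _ _ _ _)) ?lerDl // (le_trans (knot_le ji)).
    apply: (@le_trans _ _ (A (knot c i) x)).
      apply: le_trans (gauge_subadd gA _ (knot_ge0 i) ix x1) _ => //.
      by rewrite -{1}(knot0 c) gauge_dead ?add0r.
    apply: (@le_trans _ _ (K1 * B (knot c i) x + D * r ^+ n.+1)); last first.
      by rewrite lerD2r ler_pM2l //; apply: gauge_mono.
    by rewrite xE !gauge_left //; case: ifP => _; apply: err_mono.
  have [[j /andP[ij _] lj]|dead] := aliveP i.+1 m.
    apply: (@le_trans _ _ D); first exact: gauge_mono.
    by rewrite (le_trans (big_cell j x 1 _ _ _ _ _)) ?lerDl // (le_trans xi (knot_le ij)).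
  apply: (@le_trans _ _ (A x (knot c i.+1))).
    apply: le_trans (gauge_subadd gA x0 xi (knot_le1 _) _) _ => //.
    have -> : A (knot c i.+1) 1 = 0.
      by rewrite -[X in A _ X]c_sum -(knot_max c) gauge_dead // ltn_ord leqnn.
    by rewrite addr0.
  apply: (@le_trans _ _ (K1 * B x (knot c i.+1) + D * r ^+ n.+1)); last first.
    by rewrite lerD2r ler_pM2l //; apply: gauge_mono.
  by rewrite xE !gauge_right //; case: ifP => _; apply: err_mono.
(* On whole cells the two sizes are in the exact ratio [D / E], or both zero, and there are at most
   m of them. *)
have middle (a b : nat) t u : (a <= b <= m)%N -> 0 <= t -> t <= knot c a -> knot c b <= u ->
    u <= 1 -> A (knot c a) (knot c b) <= m%:R * (D / E) * B t u.
  move=> /andP[ab bm] t0 ta bu u1.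
  have B0 : 0 <= B t u.
    by rewrite gauge_ge0 // (le_trans ta) // (le_trans (knot_le ab)).
  apply: (@le_trans _ _ ((b - a)%:R * (D / E * B t u))); last first.
    rewrite -[leRHS]mulrA ler_wpM2r ?ler_nat ?(leq_trans (leq_subr _ _)) //.
    by rewrite mulr_ge0 // divr_ge0 // ltW.
  elim: b ab bm bu => [|b IH] ab bm bu.
    by move: ab; rewrite leqn0 => /eqP ->; rewrite gauge_refl // mul0r.
  move: ab; rewrite leq_eqVlt => /orP[/eqP ->|ab]; first by rewrite gauge_refl // subnn mul0r.
  rewrite ltnS in ab.
  have bu' : knot c b <= u by rewrite (le_trans _ bu) ?knot_le.
  apply: le_trans (gauge_subadd gA _ (knot_le ab) (knot_le (leqnSn b)) _) _ => //.
  rewrite subSn // -natr1 mulrDl mul1r lerD ?IH //; first exact: ltnW.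
  rewrite (gauge_cell (Ordinal bm)) //.
  apply: (@le_trans _ _ (D / E * B (knot c b) (knot c b.+1))).
    by rewrite (gauge_cell (Ordinal bm)) // -/D -/E [lam _ * E]mulrC mulrA divfK ?gt_eqF // mulrC.
  rewrite ler_pM2l ?divr_gt0 //; apply: gauge_mono; rewrite ?knot_le //.
  by rewrite (le_trans ta) // knot_le.
have E_ratio : 0 <= D / E by rewrite divr_ge0 ?ltW.
(* Two end pieces cost [K1] each, and at most m whole cells between them cost [D / E] each. *)
set K2 := K1 + K1 + m%:R * (D / E).
have K12 : K1 <= K2.
  by have := mulr_ge0 (ler0n R m) E_ratio; rewrite /K2; lra.
exists K2 => [|t u t0 tu u1]; first exact: lt_le_trans K12.
(* One error term for each end piece. *)
apply: (@le_of_geometric_error _ r (D + D)) => [|n]; first by rewrite r0.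
elim: n t u t0 tu u1 => [|n IH] t u t0 tu u1.
  have KB0 : 0 <= K2 * B t u.
    by apply: mulr_ge0; [exact: le_trans (ltW K10) K12 | exact: gauge_ge0].
  have := A_le _ _ t0 tu u1; rewrite expr0 mulr1; lra.
have [[i [x [y [x0 xy y1 -> ->]]]]|] := cell_pair c_gt0 c_sum t0 tu u1.
  rewrite !(gauge_scale _ _ x0 xy y1) //.
  have hyp a b : a <= K2 * b + (D + D) * r ^+ n ->
      lam i * a <= K2 * (lam i * b) + (D + D) * r ^+ n.+1.
    move=> /(ler_wpM2l (lam_ge0 i)) /le_trans -> //.
    by rewrite mulrDr mulrCA lerD2l mulrCA ler_pM2l ?addr_gt0 // exprS ler_wpM2r ?exprn_ge0.
  case: ifP => _; apply: hyp; apply: IH => //; lra.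
move=> [i [j [x [y [ij x01 y01 tE uE]]]]].
have /andP[_ ti] : knot c i <= t <= knot c i.+1 by rewrite tE sub_knot_itv.
have /andP[ju _] : knot c j <= u <= knot c j.+1 by rewrite uE sub_knot_itv.
have ijk := knot_le ij.
have h1 : A t u <= A t (knot c i.+1) + (A (knot c i.+1) (knot c j) + A (knot c j) u).
  apply: le_trans (gauge_subadd gA t0 ti _ u1) _; first exact: le_trans ijk ju.
  by rewrite lerD2l; exact: gauge_subadd.
have h2 : A t (knot c i.+1) <= K1 * B t u + D * r ^+ n.+1.
  apply: (@le_trans _ _ (K1 * B t (knot c i.+1) + D * r ^+ n.+1)); last first.
    by rewrite lerD2r ler_pM2l //; apply: gauge_mono => //; exact: le_trans ijk ju.
  rewrite tE !gauge_right //; case: ifP => _; apply: err_mono.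
    exact: (one_sided n _ (flip_itv true x01)).1.
  exact: (one_sided n _ x01).2.
have h3 : A (knot c j) u <= K1 * B t u + D * r ^+ n.+1.
  apply: (@le_trans _ _ (K1 * B (knot c j) u + D * r ^+ n.+1)); last first.
    by rewrite lerD2r ler_pM2l //; apply: gauge_mono => //; exact: le_trans ti ijk.
  rewrite uE !gauge_left //; case: ifP => _; apply: err_mono.
    exact: (one_sided n _ (flip_itv true y01)).2.
  exact: (one_sided n _ y01).1.
have h4 : A (knot c i.+1) (knot c j) <= m%:R * (D / E) * B t u.
  by apply: middle => //; rewrite ij ltnW.
by rewrite /K2; lra.
Qed.

End Gauge.

(** * Endpoint values, scaling and boundedness of solutions *)

Section FormStar.
Variables (R : realType) (d m : nat) (c lam : 'I_m -> R) (eps : 'I_m -> bool).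
Variable f : R -> 'rV[R]_d.

Lemma pt_inE (e : bool) : pt_in R d e = if e then pt_b R d else pt_a R d.
Proof. by case: e; rewrite /pt_in /= ?subrr ?subr0 ?scale1r ?scale0r ?add0r ?addr0. Qed.

Lemma pt_outE (e : bool) : pt_out R d e = if e then pt_a R d else pt_b R d.
Proof. by case: e; rewrite /pt_out /= ?subrr ?subr0 ?scale1r ?scale0r ?add0r ?addr0. Qed.

Lemma form_phi S i t : of_form_star_with c lam eps S f -> 0 <= t <= 1 ->
  f (phi c eps i t) = S i (f t).
Proof.
move=> fS t01; rewrite (fs_eqn fS (phi_piece c eps i t01)) phiK //.
by rewrite gt_eqF // (fs_c_gt0 fS).
Qed.

Lemma form_lam_itv S i : of_form_star_with c lam eps S f -> 0 <= lam i < 1.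
Proof. by move=> fS; case: (fs_simil fS i). Qed.

Lemma form_scaling S i x y : of_form_star_with c lam eps S f ->
  0 <= x <= 1 -> 0 <= y <= 1 ->
  enorm (f (phi c eps i x) - f (phi c eps i y)) = lam i * enorm (f x - f y).
Proof.
by move=> fS x01 y01; rewrite !(form_phi _ fS) //; case: (fs_simil fS i) => _ ->.
Qed.

(** The values at 0 and 1 are not prescribed. Their distances X and Y from a and b satisfy linear
    relations such as X = lam_i X or X = lam_i Y, with ratios below 1, so both vanish. *)
Lemma form_endpoints S : of_form_star_with c lam eps S f -> f 0 = pt_a R d /\ f 1 = pt_b R d.
Proof.
move=> fS; have c_gt0 := fs_c_gt0 fS; have c_sum := fs_c_sum fS.
have m0 : (0 < m)%N := num_pieces_gt0 c_sum.
have m1 : (m.-1 < m)%N by rewrite prednK.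
pose i := Ordinal m0; pose j := Ordinal m1.
set X := enorm (f 0 - pt_a R d); set Y := enorm (f 1 - pt_b R d).
have XE : X = lam i * (if eps i then Y else X).
  have E0 : 0 = phi c eps i (flip (eps i) 0) :> R by rewrite phi_flip knot0 add0r mulr0.
  rewrite {1}/X {1}E0 (form_phi _ fS) ?flip_itv ?lexx ?ler01 // -(fs_first fS (i := i)) //.
  case: (fs_simil fS i) => _ ->; rewrite pt_inE /flip; case: (eps i) => //.
  by rewrite subr0.
have YE : Y = lam j * (if eps j then X else Y).
  have E1 : 1 = phi c eps j (flip (eps j) 1) :> R.
    by rewrite phi_flip mulr1 -knotS /= prednK // knot_max c_sum.
  rewrite {1}/Y {1}E1 (form_phi _ fS) ?flip_itv ?lexx ?ler01 // -(fs_last fS (i := j)) ?prednK //.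
  case: (fs_simil fS j) => _ ->; rewrite pt_outE /flip; case: (eps j) => //.
  by rewrite subrr.
have X0 : 0 <= X by exact: enorm_ge0.
have Y0 : 0 <= Y by exact: enorm_ge0.
have /andP[li0 li1] := form_lam_itv i fS.
have /andP[lj0 lj1] := form_lam_itv j fS.
suff [XE0 YE0] : X = 0 /\ Y = 0 by split; exact: enormB_eq0.
by move: XE YE; case: (eps i); case: (eps j) => XE YE; split; nra.
Qed.

Lemma form_unit S : of_form_star_with c lam eps S f -> enorm (f 1 - f 0) = 1.
Proof.
by move=> fS; have [-> ->] := form_endpoints fS; apply: enorm_pt_b; exact: fs_dim fS.
Qed.

Lemma form_bounded S : of_form_star_with c lam eps S f ->
  exists M, forall t, 0 <= t <= 1 -> enorm (f t) <= M.
Proof.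
move=> fS.
have /compact_bounded [N [_ /(_ (N + 1))]] := continuous_compact (fs_cont fS) (@segment_compact R 0 1).
rewrite ltrDl ltr01 => /(_ isT) bnd.
exists (d%:R * (N + 1)) => t t01; rewrite (le_trans (enorm_le_mx_norm _)) // ler_wpM2l //.
by apply: bnd; exists t => //=; rewrite in_itv.
Qed.

End FormStar.

(** * The oscillation of a solution as a gauge *)

Section Oscillation.
Variables (R : realType) (d m : nat) (c lam : 'I_m -> R) (eps : 'I_m -> bool).
Variable f : R -> 'rV[R]_d.

Definition osc (t u : R) : R :=
  sup [set z | exists x y, [/\ t <= x <= u, t <= y <= u & z = enorm (f x - f y)]].

Hypothesis f_bounded : exists M, forall t, 0 <= t <= 1 -> enorm (f t) <= M.

Lemma le_osc t u x y : 0 <= t -> u <= 1 -> t <= x <= u -> t <= y <= u ->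
  enorm (f x - f y) <= osc t u.
Proof.
move=> t0 u1 xtu ytu; apply: ub_le_sup; last by exists x, y.
have [M fM] := f_bounded; exists (M + M) => z [x' [y' [/andP[h1 h2] /andP[h3 h4] ->]]].
rewrite (le_trans (ler_enormD _ _)) // enormN lerD // fM //.
  by rewrite (le_trans t0) // (le_trans h2).
by rewrite (le_trans t0) // (le_trans h4).
Qed.

Lemma osc_le t u M : t <= u ->
  (forall x y, t <= x <= u -> t <= y <= u -> enorm (f x - f y) <= M) -> osc t u <= M.
Proof.
move=> tu h; apply: ge_sup; first by exists (enorm (f t - f t)), t, t; rewrite lexx tu.
by move=> z [x [y [xtu ytu ->]]]; exact: h.
Qed.

Hypotheses (c_gt0 : forall i, 0 < c i) (c_sum : \sum_i c i = 1).
Hypothesis lam01 : forall i, 0 <= lam i < 1.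
Hypothesis f_unit : enorm (f 1 - f 0) = 1.
Hypothesis f_scaling : forall i x y, 0 <= x <= 1 -> 0 <= y <= 1 ->
  enorm (f (phi c eps i x) - f (phi c eps i y)) = lam i * enorm (f x - f y).

Let c_ge0 i : 0 <= c i. Proof. exact: ltW. Qed.

Lemma osc_cell (i : 'I_m) x y : 0 <= x -> x <= y -> y <= 1 ->
  osc (phi c eps i (flip (eps i) x)) (phi c eps i (flip (eps i) y)) =
  lam i * (if eps i then osc (1 - y) (1 - x) else osc x y).
Proof.
move=> x0 xy y1.
have /andP[l0 _] := lam01 i.
set X := phi _ _ _ (flip _ x); set Y := phi _ _ _ (flip _ y).
have XE : X = knot c i + c i * x by rewrite /X phi_flip.
have YE : Y = knot c i + c i * y by rewrite /Y phi_flip.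
have XY : X <= Y by rewrite XE YE lerD2l ler_pM2l.
have x01 : 0 <= x <= 1 by rewrite x0 (le_trans xy).
have y01 : 0 <= y <= 1 by rewrite y1 (le_trans x0).
have X0 : 0 <= X by case/andP: (phi_itv eps i c_ge0 c_sum (flip_itv (eps i) x01)).
have Y1 : Y <= 1 by case/andP: (phi_itv eps i c_ge0 c_sum (flip_itv (eps i) y01)).
(* [[a, b]] is the preimage of [[X, Y]]; a reversed piece exchanges its ends. *)
pose a := if eps i then 1 - y else x; pose b := if eps i then 1 - x else y.
have -> : (if eps i then osc (1 - y) (1 - x) else osc x y) = osc a b.
  by rewrite /a /b; case: (eps i).
have ab : a <= b by rewrite /a /b; case: (eps i) => //; lra.
have a0 : 0 <= a by rewrite /a; case: (eps i) => //; lra.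
have b1 : b <= 1 by rewrite /b; case: (eps i) => //; lra.
have phi_ab z : a <= z <= b -> X <= phi c eps i z <= Y.
  rewrite XE YE phiE !lerD2l !ler_pM2l // /a /b /flip; case: (eps i) => //; lra.
have phi_XY z : X <= z <= Y -> exists2 w, a <= w <= b & z = phi c eps i w.
  move=> zXY; exists (flip (eps i) ((z - knot c i) / c i)); last first.
    by rewrite phi_flip mulrC divfK ?subrKC // gt_eqF.
  have : x <= (z - knot c i) / c i <= y.
    by rewrite ler_pdivlMr // ler_pdivrMr // lerBrDl lerBlDl ![_ * c i]mulrC -XE -YE.
  by rewrite /a /b /flip; case: (eps i) => //; lra.
apply/le_anti/andP; split.
  apply: osc_le => // _ _ /phi_XY[z zab ->] /phi_XY[w wab ->].
  rewrite f_scaling; [|lra|lra]; rewrite ler_wpM2l //; exact: le_osc.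
have [->|li0] := eqVneq (lam i) 0.
  by rewrite mul0r (le_trans (enorm_ge0 (f X - f X))) // le_osc // lexx XY.
have lp : 0 < lam i by rewrite lt0r li0.
rewrite mulrC -ler_pdivlMr //; apply: osc_le => // z w zab wab.
rewrite ler_pdivlMr // mulrC -f_scaling; [|lra|lra].
by apply: le_osc => //; exact: phi_ab.
Qed.

Lemma gauge_osc : gauge c lam eps osc.
Proof.
split.
- move=> t; rewrite /osc (_ : [set z | _] = [set 0]) ?sup1 //.
  apply/seteqP; split => z /=.
    by move=> [x [y [/le_anti <- /le_anti <- ->]]]; rewrite subrr enorm0.
  by move=> ->; exists t, t; rewrite lexx subrr enorm0.
- apply: (@lt_le_trans _ _ 1) => //; rewrite -{1}f_unit; apply: le_osc; lra.
- move=> t t' u' u t0 tt' t'u' u'u u1; apply: osc_le => // x y /andP[h1 h2] /andP[h3 h4].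
  by apply: le_osc => //; lra.
- move=> t u v t0 tu uv v1; have u1 : u <= 1 := le_trans uv v1; have u0 := le_trans t0 tu.
  have o1 : 0 <= osc t u.
    by rewrite (le_trans (enorm_ge0 (f t - f t))) // le_osc // lexx tu.
  have o2 : 0 <= osc u v.
    by rewrite (le_trans (enorm_ge0 (f v - f v))) // le_osc // lexx uv.
  have cross x y : t <= x <= u -> u <= y <= v -> enorm (f x - f y) <= osc t u + osc u v.
    move=> xtu yuv; apply: le_trans (ler_enorm_dist (f u) _ _) _.
    by apply: lerD; apply: le_osc => //; lra.
  apply: osc_le => [|x y xtv ytv]; first exact: le_trans uv.
  have [xu|ux] := lerP x u; have [yu|uy] := lerP y u.
  + by rewrite ler_wpDr // le_osc //; lra.
  + by apply: cross; lra.
  + by rewrite enormB; apply: cross; lra.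
  + by rewrite ler_wpDl // le_osc //; lra.
- by move=> i x y x0 xy y1; rewrite -!(phi_flip c eps) osc_cell.
Qed.

End Oscillation.

(** * The time change *)

Section TimeChange.
Variables (R : realType) (m : nat) (c p : 'I_m -> R) (eps : 'I_m -> bool).

(** The similitudes of g are pinned to the affine maps [phi p eps i], so g is a conjugacy between
    two partitions of [0, 1]; continuity becomes a consequence. *)
Record time_change (g : R -> R) : Prop := TimeChange {
  tc_mono : forall t t', 0 <= t -> t <= t' -> t' <= 1 -> g t <= g t';
  tc_0 : g 0 = 0;
  tc_1 : g 1 = 1;
  tc_conj : forall i t, 0 <= t <= 1 -> g (phi c eps i t) = phi p eps i (g t) }.

Hypotheses (c_gt0 : forall i, 0 < c i) (c_sum : \sum_i c i = 1).
Hypotheses (p01 : forall i, 0 <= p i < 1) (p_sum : \sum_i p i = 1).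

Let c_ge0 i : 0 <= c i. Proof. exact: ltW. Qed.
Let p_ge0 i : 0 <= p i. Proof. by case/andP: (p01 i). Qed.

(** A class that contains the identity and is stable under the operator constructing g; continuity
    is not imposed on the iterates. *)
Definition monotone_onto (u : R -> R) : Prop :=
  [/\ forall t t', 0 <= t -> t <= t' -> t' <= 1 -> u t <= u t', u 0 = 0 & u 1 = 1].

Lemma monotone_onto_itv u t : monotone_onto u -> 0 <= t <= 1 -> 0 <= u t <= 1.
Proof.
move=> [um u0 u1] /andP[t0 t1].
by rewrite -{1}u0 -{1}u1 !um // ?lexx // (le_trans t0 t1).
Qed.

Lemma monotone_onto_flip u e x y : monotone_onto u -> 0 <= x -> x <= y -> y <= 1 ->
  flip e (u (flip e x)) <= flip e (u (flip e y)).
Proof.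
move=> [um _ _] x0 xy y1; rewrite /flip; case: e; last exact: um.
by rewrite lerD2l lerN2; apply: um; lra.
Qed.

Lemma time_change_onto g : time_change g -> monotone_onto g.
Proof. by case. Qed.

(** Different cells meet only where they are consecutive, at their common division point; there both
    formulas give the matching division point of the range. This makes the operator independent of
    the chosen cell. *)
Lemma phi_glue u (i j : 'I_m) x y : monotone_onto u -> (i < j)%N ->
  0 <= x <= 1 -> 0 <= y <= 1 -> phi c eps i x = phi c eps j y ->
  phi p eps i (u x) = phi p eps j (u y).
Proof.
move=> [_ u0 u1] ij x01 y01; rewrite !phiE => E.
have /andP[_ hi] := sub_knot_itv i c_ge0 c_sum (flip_itv (eps i) x01).
have /andP[hj _] := sub_knot_itv j c_ge0 c_sum (flip_itv (eps j) y01).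
have ijk : knot c i.+1 <= knot c j by exact: ler_knot.
have Ei : knot c i + c i * flip (eps i) x = knot c i.+1 by lra.
have Ej : knot c j + c j * flip (eps j) y = knot c j by lra.
have jE : j = i.+1 :> nat.
  apply/eqP; rewrite eqn_leq ij andbT leqNgt; apply/negP => ij'.
  have i1m : (i.+1 < m)%N := leq_trans ij' (ltnW (ltn_ord j)).
  have : knot c i.+1 < knot c j by apply: (knot_ord_lt c_gt0 (i := Ordinal i1m)).
  by move: Ei Ej; rewrite E => -> ->; rewrite ltxx.
have flip_u0 e z : flip e z = 0 -> flip e (u z) = 0.
  rewrite /flip; case: e => h; last by rewrite h u0.
  by rewrite (_ : z = 1) ?u1 ?subrr //; lra.
have flip_u1 e z : flip e z = 1 -> flip e (u z) = 1.
  rewrite /flip; case: e => h; last by rewrite h u1.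
  by rewrite (_ : z = 0) ?u0 ?subr0 //; lra.
have -> : flip (eps i) (u x) = 1.
  apply: flip_u1; apply: (mulfI (lt0r_neq0 (c_gt0 i))).
  by move: Ei; rewrite knotS mulr1; lra.
have -> : flip (eps j) (u y) = 0.
  apply: flip_u0; apply: (mulfI (lt0r_neq0 (c_gt0 j))).
  by rewrite mulr0; lra.
by rewrite mulr1 mulr0 addr0 -knotS jE.
Qed.

Lemma cell_index_exists : exists idx : R -> 'I_m,
  forall t, 0 <= t <= 1 -> exists2 x, 0 <= x <= 1 & t = phi c eps (idx t) x.
Proof.
suff /choice[idx] : forall t, exists i, 0 <= t <= 1 ->
    exists2 x, 0 <= x <= 1 & t = phi c eps i x by exists idx.
move=> t; have [t01|nt] := boolP (0 <= t <= 1).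
  by have [i ix] := phi_exists c_gt0 c_sum eps t01; exists i.
by exists (Ordinal (num_pieces_gt0 c_sum)).
Qed.

(* The operator u |-> T u whose fixed points are the solutions of tc_conj. *)
Lemma cascade_exists : exists T : (R -> R) -> R -> R,
  (forall u, monotone_onto u -> forall i x, 0 <= x <= 1 ->
    T u (phi c eps i x) = phi p eps i (u x)) /\
  (forall u, monotone_onto u -> monotone_onto (T u)).
Proof.
have [idx idxP] := cell_index_exists.
pose T (u : R -> R) t := phi p eps (idx t) (u (phi_inv c eps (idx t) t)).
have T_phi u : monotone_onto u -> forall i x, 0 <= x <= 1 ->
    T u (phi c eps i x) = phi p eps i (u x).
  move=> uM i x x01; rewrite /T; set t := phi c eps i x.
  have [y y01 tE] := idxP t (phi_itv eps i c_ge0 c_sum x01).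
  have -> : phi_inv c eps (idx t) t = y by rewrite {2}tE phiK ?gt_eqF.
  case: (ltngtP i (idx t)) => ij.
  - by apply/esym/phi_glue.
  - by apply/phi_glue.
  - have E : i = idx t by exact: val_inj.
    rewrite -E in tE *; congr (phi p eps i (u _)).
    by rewrite -(phiK eps y (lt0r_neq0 (c_gt0 i))) -tE /t phiK ?gt_eqF.
exists T; split => // u uM.
have T_cell (i : 'I_m) x : 0 <= x <= 1 ->
    T u (knot c i + c i * x) = knot p i + p i * flip (eps i) (u (flip (eps i) x)).
  by move=> x01; rewrite -(phi_flip c eps) T_phi ?flip_itv // phiE.
have flip01 e x : 0 <= x <= 1 -> 0 <= flip e (u (flip e x)) <= 1.
  by move=> x01; rewrite flip_itv // monotone_onto_itv // flip_itv.
have [um u0 u1] := uM; have m0 := num_pieces_gt0 c_sum; split.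
- move=> t t' t0 tt' t'1.
  have [[i [x [y [x0 xy y1 -> ->]]]]|[i [j [x [y [ij x01 y01 -> ->]]]]]] :=
    cell_pair c_gt0 c_sum t0 tt' t'1.
    rewrite !T_cell; [|lra|lra].
    by rewrite lerD2l ler_wpM2l // monotone_onto_flip.
  rewrite !T_cell //; apply: (@le_trans _ _ (knot p i.+1)).
    by case/andP: (sub_knot_itv i p_ge0 p_sum (flip01 (eps i) _ x01)).
  apply: (@le_trans _ _ (knot p j)); first exact: ler_knot.
  by case/andP: (sub_knot_itv j p_ge0 p_sum (flip01 (eps j) _ y01)).
- have {1}-> : 0 = knot c (Ordinal m0) + c (Ordinal m0) * 0 :> R by rewrite knot0 mulr0 addr0.
  rewrite T_cell ?lexx ?ler01 // knot0 add0r /flip; case: (eps _).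
    by rewrite subr0 u1 subrr mulr0.
  by rewrite u0 mulr0.
- have m1 : (m.-1 < m)%N by rewrite prednK.
  have {1}-> : 1 = knot c (Ordinal m1) + c (Ordinal m1) * 1 :> R.
    by rewrite mulr1 -knotS /= prednK // knot_max.
  rewrite T_cell ?lexx ?ler01 //.
  have -> : flip (eps (Ordinal m1)) (u (flip (eps (Ordinal m1)) 1)) = 1.
    by rewrite /flip; case: (eps _); rewrite ?subrr ?u0 ?subr0 ?u1.
  by rewrite mulr1 -knotS /= prednK // knot_max.
Qed.

(** Iteration from the identity: the operator contracts by the largest [p i], and monotonicity,
    endpoint values and the conjugacy equation pass to pointwise limits with a geometric error. *)
Lemma time_change_exists : exists g, time_change g.
Proof.
have [T [T_phi T_onto]] := cascade_exists.
have [r /andP[r0 r1] pr] := finite_ratio_bound p01.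
have r01 : 0 <= r < 1 by rewrite r0.
pose u n := iter n T id.
have uM n : monotone_onto (u n).
  by elim: n => [|n IH]; [split | exact: T_onto].
have u_phi n i x : 0 <= x <= 1 -> u n.+1 (phi c eps i x) = phi p eps i (u n x) by exact: T_phi.
have step n t : 0 <= t <= 1 -> `|u n.+1 t - u n t| <= r ^+ n.
  elim: n t => [|n IH] t t01.
    rewrite expr0 /u ler_norml /=.
    by have := monotone_onto_itv (uM 1%N) t01; rewrite /u /= => h; lra.
  have [i [x x01 ->]] := phi_exists c_gt0 c_sum eps t01.
  rewrite !u_phi // !phiE.
  rewrite opprD addrACA subrr add0r -mulrBr normrM flip_dist ger0_norm //.
  by rewrite exprS ler_pM // IH.
pose K := (1 - r)^-1.
have /choice[g gP] t : exists l, 0 <= t <= 1 -> forall n, `|l - u n t| <= K * r ^+ n.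
  have [t01|nt] := boolP (0 <= t <= 1); last by exists 0.
  by have [l lP] := geometric_limit r01 (fun n => step n t t01); exists l.
have eq_geo (M a b : R) : (forall n, `|a - b| <= M * r ^+ n) -> a = b.
  move=> h; apply/subr0_eq/eqP; rewrite -normr_le0.
  by apply: (le_of_geometric_error (K := M) r01) => n; rewrite add0r.
exists g; split.
- move=> t t' t0 tt' t'1; apply: (le_of_geometric_error (K := K + K) r01) => n.
  have /gP/(_ n) h1 : 0 <= t <= 1 by lra.
  have /gP/(_ n) h2 : 0 <= t' <= 1 by lra.
  have [/(_ _ _ t0 tt' t'1) h3 _ _] := uM n.
  by move: h1 h2; rewrite !ler_norml => /andP[h1 h1'] /andP[h2 h2']; lra.
- apply: (eq_geo K) => n; have [_ E _] := uM n; rewrite -[X in _ - X]E; apply: gP; lra.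
- apply: (eq_geo K) => n; have [_ _ E] := uM n; rewrite -[X in _ - X]E; apply: gP; lra.
(* The error at the image point after n + 1 iterations, plus [p i] <= 1 times the error at x after n
   iterations. *)
- move=> i x x01; apply: (eq_geo (K * r + K)) => n.
  rewrite (le_trans (ler_distD (u n.+1 (phi c eps i x)) _ _)) // [leRHS]mulrDl.
  rewrite lerD //; first by rewrite -mulrA -exprS; exact/gP/phi_itv.
  rewrite u_phi // !phiE opprD addrACA subrr add0r -mulrBr normrM flip_dist.
  rewrite (ger0_norm (p_ge0 i)) distrC -[leRHS]mul1r ler_pM ?gP //.
  by case/andP: (p01 i) => _ /ltW.
Qed.

Lemma time_change_unique g g' t : time_change g -> time_change g' -> 0 <= t <= 1 -> g' t = g t.
Proof.
move=> gT g'T t01; have [r r01 pr] := finite_ratio_bound p01.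
apply/subr0_eq/eqP; rewrite -normr_le0.
apply: (le_of_geometric_error (K := 1) r01) => n; rewrite add0r mul1r.
elim: n t t01 => [|n IH] t t01.
  have := monotone_onto_itv (time_change_onto gT) t01.
  have := monotone_onto_itv (time_change_onto g'T) t01.
  by rewrite expr0 ler_norml => h h'; apply/andP; split; lra.
have [i [x x01 ->]] := phi_exists c_gt0 c_sum eps t01.
rewrite (tc_conj gT) // (tc_conj g'T) // !phiE.
rewrite opprD addrACA subrr add0r -mulrBr normrM flip_dist ger0_norm //.
by rewrite exprS ler_pM // IH.
Qed.

Lemma time_change_cell g (i : 'I_m) x : time_change g -> 0 <= x <= 1 ->
  g (knot c i + c i * x) = knot p i + p i * flip (eps i) (g (flip (eps i) x)).
Proof. by move=> gT x01; rewrite -(phi_flip c eps) (tc_conj gT) ?flip_itv // phiE. Qed.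

(** Each generation costs a factor k, the smallest [c i], in the domain and a factor at most r in
    the range. Points closer than k^n lie in one cell or in two adjacent ones; in the second case
    each side contributes r^n, whence 2 r^n. *)
Lemma time_change_uniform g (e : R) : time_change g -> 0 < e ->
  exists2 delta, 0 < delta & forall t u, 0 <= t -> t <= u -> u <= 1 ->
    u - t < delta -> g u - g t < e.
Proof.
move=> gT e0.
have [r /andP[r0 r1] pr] := finite_ratio_bound p01.
have r01 : 0 <= r < 1 by rewrite r0.
have [k /andP[k0 k1] kc'] := finite_positive_bound c.
have kc i : k <= c i by exact: kc'.
have gM := time_change_onto gT; have [gm g0 g1] := gM.
have [n hn] := geometric_small 2 r01 e0.
exists (k ^+ n) => [|t u t0 tu u1 tun]; first exact: exprn_gt0.
apply: le_lt_trans hn.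
have small j (i : 'I_m) x : c i * x < k ^+ j.+1 -> x < k ^+ j.
  rewrite exprS => h; rewrite -(ltr_pM2l (c_gt0 i)); apply: lt_le_trans h _.
  by rewrite ler_wpM2r // exprn_ge0 // ltW.
have pow_le j : k ^+ j.+1 <= k by rewrite exprS ler_piMr ?exprn_ile1 // ltW.
have shrink j (i : 'I_m) a b : a <= b * r ^+ j -> 0 <= b -> p i * a <= b * r ^+ j.+1.
  move=> ab b0; apply: (@le_trans _ _ (p i * (b * r ^+ j))); first by rewrite ler_wpM2l.
  by rewrite exprS mulrCA ler_wpM2l // ler_wpM2r // exprn_ge0.
have ends_cell j (i : 'I_m) y :
    (forall x, 0 <= x <= 1 -> (x < k ^+ j -> g x <= 1 * r ^+ j) /\
      (1 - x < k ^+ j -> 1 - g x <= 1 * r ^+ j)) ->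
    0 <= y <= 1 -> (c i * y < k ^+ j.+1 ->
      g (knot c i + c i * y) - knot p i <= 1 * r ^+ j.+1) /\
    (c i * (1 - y) < k ^+ j.+1 ->
      knot p i.+1 - g (knot c i + c i * y) <= 1 * r ^+ j.+1).
  move=> IH y01; rewrite time_change_cell // knotS.
  have [IH0 IH1] := IH _ y01; have [IH0' IH1'] := IH _ (flip_itv true y01).
  split => /small yk.
    rewrite addrAC subrr add0r; apply: shrink => //.
    move: IH0' IH1'; rewrite /flip; case: (eps i) => IH0' IH1'; last exact: IH0.
    by apply: IH1'; lra.
  rewrite opprD addrACA subrr add0r -[X in X - _]mulr1 -mulrBr; apply: shrink => //.
  move: IH0' IH1'; rewrite /flip; case: (eps i) => IH0' IH1'; last exact: IH1.
  by rewrite subKr; apply: IH0'.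
have ends j x : 0 <= x <= 1 -> (x < k ^+ j -> g x <= 1 * r ^+ j) /\
    (1 - x < k ^+ j -> 1 - g x <= 1 * r ^+ j).
  elim: j x => [|j IH] x x01.
    by have := monotone_onto_itv gM x01; rewrite expr0 mulr1; split=> _; lra.
  have [i [y y01 xE]] := cell_exists c_gt0 c_sum x01.
  have [e0' e1'] := ends_cell j i y IH y01.
  have /andP[ix xi] := sub_knot_itv i c_ge0 c_sum y01.
  have kj := pow_le j.
  split => xk.
    (* Every cell has length at least k, so a point below k can only lie in the first one. *)
    have i0 : i = 0%N :> nat.
      apply/eqP; rewrite -leqn0 leqNgt; apply/negP => i0.
      have m0 := num_pieces_gt0 c_sum.
      have := ler_knot c_ge0 i0; have := kc (Ordinal m0).
      by rewrite (knotS c (Ordinal m0)) knot0 add0r; lra.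
    have := e0'; rewrite -xE !i0 !knot0 subr0; apply.
    by move: xk; rewrite xE i0 knot0 add0r.
  have im : i.+1 = m.
    apply/eqP; rewrite eqn_leq ltn_ord leqNgt; apply/negP => i1.
    have := ler_knot c_ge0 (ltn_ord (Ordinal i1)); have := kc (Ordinal i1).
    by rewrite (knotS c (Ordinal i1)) knot_max c_sum /=; lra.
  have := e1'; rewrite -xE im knot_max p_sum; apply.
  rewrite mulrBr mulr1; move: xk; rewrite xE.
  have : knot c i + c i = 1 by rewrite -knotS im knot_max.
  by lra.
elim: n t u t0 tu u1 tun => [|n IH] t u t0 tu u1 tun.
  have t01 : 0 <= t <= 1 by lra.
  have u01 : 0 <= u <= 1 by lra.
  have := monotone_onto_itv gM t01; have := monotone_onto_itv gM u01.
  by rewrite expr0; lra.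
have [[i [x [y [x0 xy y1 tE uE]]]]|[i [j [x [y [ij x01 y01 tE uE]]]]]] :=
  cell_pair c_gt0 c_sum t0 tu u1.
  have xyk : y - x < k ^+ n.
    by apply: (small n i); move: tun; rewrite tE uE mulrBr; lra.
  rewrite tE uE !time_change_cell //; [|lra|lra].
  rewrite opprD addrACA subrr add0r -mulrBr; apply: shrink => //.
  rewrite /flip; case: (eps i); last by apply: IH.
  have : g (1 - x) - g (1 - y) <= 2 * r ^+ n by apply: IH; lra.
  by lra.
have kj := pow_le n.
have ti := sub_knot_itv i c_ge0 c_sum x01.
have uj := sub_knot_itv j c_ge0 c_sum y01.
(* A cell lying between t and u would separate them by at least k. *)
have jE : j = i.+1 :> nat.
  apply/eqP; rewrite eqn_leq ij andbT leqNgt; apply/negP => ij'.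
  have i1m : (i.+1 < m)%N := leq_trans ij' (ltnW (ltn_ord j)).
  have := ler_knot c_ge0 ij'; have := kc (Ordinal i1m).
  move: ti uj => /andP[ti1 ti2] /andP[uj1 uj2].
  by rewrite (knotS c (Ordinal i1m)) /= => h1 h2; rewrite -tE in ti1 ti2; rewrite -uE in uj1 uj2; lra.
have [_ h1] := ends_cell n i x (ends n) x01.
have [h2 _] := ends_cell n j y (ends n) y01.
have ijk : knot c j = knot c i + c i by rewrite jE knotS.
have cx : 0 <= c i * (1 - x) by rewrite mulr_ge0 // subr_ge0; case/andP: x01.
have cy : 0 <= c j * y by rewrite mulr_ge0 //; case/andP: y01.
have tuE : u - t = c i * (1 - x) + c j * y by rewrite uE tE ijk; ring.
have /h1 h1' : c i * (1 - x) < k ^+ n.+1.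
  by apply: le_lt_trans tun; rewrite tuE lerDl.
have /h2 h2' : c j * y < k ^+ n.+1.
  by apply: le_lt_trans tun; rewrite tuE lerDr.
rewrite -tE in h1'; rewrite -uE jE in h2'; lra.
Qed.

End TimeChange.

Lemma uniform_within_continuous (R : realType) (V : normedModType R) (F : R -> V) :
  (forall e : R, 0 < e -> exists2 delta, 0 < delta & forall t u, 0 <= t -> t <= u -> u <= 1 ->
    u - t < delta -> `|F u - F t| < e) ->
  {within `[0, 1], continuous F}.
Proof.
move=> unif; apply/subspace_continuousP => x /=; rewrite in_itv /= => /andP[x0 x1].
apply/cvgrPdist_lt => e /unif[delta delta0 F_unif].
rewrite near_withinE; apply/nbhs_ballP; exists delta => //= t; rewrite /ball /= => xt.
rewrite in_itv /= => /andP[t0 t1].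
case: (leP x t) => h; last by apply: F_unif => //; [exact: ltW | exact: le_lt_trans (ler_norm _) xt].
rewrite distrC; apply: F_unif => //; apply: le_lt_trans xt.
by rewrite distrC ler_norm.
Qed.

(** * The similarity exponent s *)

Section Exponent.
Variables (R : realType) (d m : nat) (c lam : 'I_m -> R) (eps : 'I_m -> bool).
Variables (S : 'I_m -> 'rV[R]_d -> 'rV[R]_d) (f : R -> 'rV[R]_d).
Hypothesis fS : of_form_star_with c lam eps S f.

Let c_gt0 := fs_c_gt0 fS.
Let c_sum := fs_c_sum fS.
Let lam01 i : 0 <= lam i < 1 := form_lam_itv i fS.

(** The polygon through the images of the division points joins a to b, at distance 1, and its sides
    have lengths [lam i]. This is the source of s >= 1. *)
Lemma sum_ratio_ge1 : 1 <= \sum_i lam i.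
Proof.
rewrite -(form_unit fS) -knot_max -[in f 1]c_sum -(knot_max c).
suff: forall k, (k <= m)%N -> enorm (f (knot c k) - f 0) <= knot lam k by apply.
elim=> [_|k IH km]; first by rewrite !knot0 subrr enorm0.
apply: le_trans (ler_enorm_dist (f (knot c k)) _ _) _.
rewrite (knotS lam (Ordinal km)) addrC lerD ?IH //; first exact: ltnW.
have e01 (e : bool) : 0 <= flip e (0 : R) <= 1 by rewrite flip_itv ?lexx ?ler01.
have e11 (e : bool) : 0 <= flip e (1 : R) <= 1 by rewrite flip_itv ?lexx ?ler01.
have -> : knot c k.+1 = phi c eps (Ordinal km) (flip (eps (Ordinal km)) 1).
  by rewrite phi_flip mulr1 -knotS.
have -> : knot c k = phi c eps (Ordinal km) (flip (eps (Ordinal km)) 0).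
  by rewrite phi_flip mulr0 addr0.
rewrite (form_scaling _ fS) // ler_piMr ?(proj1 (andP (lam01 _))) //.
rewrite /flip; case: (eps _); rewrite ?subr0 ?subrr ?(form_unit fS) //.
by rewrite enormB (form_unit fS).
Qed.

Lemma ratio_pos_exists : exists i, 0 < lam i.
Proof.
apply: contrapT => /forallNP h; have := sum_ratio_ge1.
rewrite big1 ?ler10 // => i _; apply/eqP; rewrite eq_le (proj1 (andP (lam01 i))) andbT.
by rewrite leNgt; apply/negP.
Qed.

Lemma sum_powR_decr (s1 s2 : R) : 0 < s1 -> s1 < s2 ->
  \sum_i lam i `^ s2 < \sum_i lam i `^ s1.
Proof.
move=> s10 s12; have s20 := lt_trans s10 s12.
have strict i : 0 < lam i -> lam i `^ s2 < lam i `^ s1.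
  move=> li; have q0 : 0 < s2 - s1 by rewrite subr_gt0.
  rewrite -(subrKC s1 s2) powRD ?(gt_eqF li) ?implybT // gtr_pMr ?powR_gt0 //.
  rewrite -[ltRHS](_ : 1 `^ (s2 - s1) = 1); last by rewrite powR1.
  rewrite gt0_ltr_powR ?nnegrE ?ler01 ?ltW //.
  by case/andP: (lam01 i).
have [i li] := ratio_pos_exists.
rewrite (bigD1 i) // [ltRHS](bigD1 i) //= ltr_leD ?strict //.
apply: ler_sum => j _; have [l0 _] := andP (lam01 j).
have [->|lj] := eqVneq (lam j) 0; first by rewrite !powR0 ?gt_eqF.
by rewrite ltW // strict // lt0r lj.
Qed.

Lemma dimension_exponent : exists s : R, [/\ 1 <= s, \sum_i lam i `^ s = 1 &
  forall s', 0 < s' -> \sum_i lam i `^ s' = 1 -> s' = s].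
Proof.
(* Omitting zero ratios and writing powers as exponentials gives a function continuous on the whole
   line. *)
pose F s := \sum_(i < m | lam i != 0) expR (s * ln (lam i)).
have FE s : 0 < s -> \sum_i lam i `^ s = F s.
  move=> s0; rewrite /F [RHS]big_mkcond /=; apply: eq_bigr => i _.
  case: ifPn => [l0|/negPn/eqP->]; last by rewrite powR0 // gt_eqF.
  by rewrite /powR (negbTE l0).
have Fcont : continuous F.
  apply: continuous_big => [|i _ s]; first exact: add_continuous.
  apply: continuous_comp; last exact: continuous_expR.
  exact: mulrr_continuous.
have [r r01 lamr] := finite_ratio_bound lam01.
(* At exponent n + 1 the sum is at most m r^n, hence below 1: the right end for the intermediate
   value theorem. *)
have [n hn] := geometric_small m%:R r01 (@ltr01 R).
have F1 : 1 <= F 1.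
  rewrite -FE // (le_trans sum_ratio_ge1) // ler_sum // => i _; rewrite powRr1 //.
  by case/andP: (lam01 i).
have Fn : F n.+1%:R <= 1.
  rewrite -FE ?ltr0Sn //; apply: le_trans (ltW hn).
  apply: (@le_trans _ _ (\sum_(i < m) r ^+ n)).
    apply: ler_sum => i _; have /andP[l0 l1] := lam01 i; rewrite powR_mulrn //.
    apply: (@le_trans _ _ (lam i ^+ n)); last by rewrite lerXn2r ?nnegrE // (le_trans l0).
    by rewrite exprS ler_piMl ?exprn_ge0 // ltW.
  by rewrite sumr_const card_ord mulr_natl.
have n1 : 1 <= n.+1%:R :> R by rewrite ler1n.
have [| |s s1n sE] := @IVT R F 1 n.+1%:R 1 n1.
- exact/continuous_subspaceT.
- by rewrite ge_min Fn orbT /= le_max F1.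
have s1 : 1 <= s by move: s1n; rewrite in_itv /= => /andP[].
have s0 : 0 < s := lt_le_trans ltr01 s1.
exists s; split => //; first by rewrite FE.
move=> s' s'0 s'E; case: (ltgtP s' s) => // h.
  by have := sum_powR_decr s'0 h; rewrite s'E FE // sE ltxx.
by have := sum_powR_decr s0 h; rewrite s'E FE // sE ltxx.
Qed.

End Exponent.

(** * Equivalence of the two descriptions of the time change *)

Section ScalarForm.
Variables (R : realType) (m : nat) (c lam : 'I_m -> R) (eps : 'I_m -> bool) (s : R).
Hypotheses (m_ge2 : (2 <= m)%N) (c_gt0 : forall i, 0 < c i) (c_sum : \sum_i c i = 1).
Hypotheses (lam01 : forall i, 0 <= lam i < 1) (s_gt0 : 0 < s).
Hypothesis lam_sum : \sum_i lam i `^ s = 1.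

Let p i := lam i `^ s.

Lemma powR_ratio_itv i : 0 <= p i < 1.
Proof.
rewrite powR_ge0 -[ltRHS](_ : 1 `^ s = 1); last by rewrite powR1.
have /andP[l0 l1] := lam01 i.
by rewrite gt0_ltr_powR ?nnegrE ?ler01 // ltW.
Qed.

(** A similitude of the line may preserve or reverse orientation, so the functional equation only
    gives absolute increments. Monotonicity of g fixes their sign, and summing them over the cells
    fixes the values at the division points. *)
Lemma time_change_of_is_time_change g : is_time_change c lam eps s g -> time_change c p eps g.
Proof.
move=> [grange gm g0 g1 [S gS]].
have scaling i x y : 0 <= x <= 1 -> 0 <= y <= 1 ->
    `|g (phi c eps i x) - g (phi c eps i y)| = p i * `|g x - g y|.
  by move=> x01 y01; rewrite -!enorm_vec1 (form_scaling _ gS).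
have p0 i : 0 <= p i by exact: powR_ge0.
have c_ge0 i : 0 <= c i by exact: ltW.
have cell (i : 'I_m) x : 0 <= x <= 1 ->
    g (knot c i + c i * x) - g (knot c i) = p i * flip (eps i) (g (flip (eps i) x)).
  move=> x01.
  have /andP[h1 h2] := sub_knot_itv i c_ge0 c_sum x01.
  have /andP[k0 _] := knot_itv i c_ge0 c_sum.
  have /andP[_ k1] := knot_itv i.+1 c_ge0 c_sum.
  rewrite -[LHS]ger0_norm ?subr_ge0; last by apply: gm => //; exact: le_trans h2 k1.
  have -> : knot c i = phi c eps i (flip (eps i) 0) by rewrite phi_flip mulr0 addr0.
  rewrite phi_flip mulr0 addr0 -(phi_flip c eps) -[in X in _ - g X](addr0 (knot c i)).
  rewrite -(mulr0 (c i)) -(phi_flip c eps) scaling ?flip_itv ?lexx ?ler01 //.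
  congr (_ * _); rewrite /flip; case: (eps i); last first.
    by rewrite g0 subr0 ger0_norm //; case/andP: (grange _ x01).
  rewrite subr0 g1 distrC ger0_norm // subr_ge0.
  by have /grange/andP[] : 0 <= 1 - x <= 1 by lra.
have g_knot k : (k <= m)%N -> g (knot c k) = knot p k.
  elim: k => [|k IH] km; first by rewrite !knot0.
  have one01 : 0 <= (1 : R) <= 1 by rewrite ler01 lexx.
  have := cell (Ordinal km) 1 one01.
  have -> : flip (eps (Ordinal km)) (g (flip (eps (Ordinal km)) 1)) = 1.
    by rewrite /flip; case: (eps _); rewrite ?subrr ?g0 ?subr0 ?g1.
  rewrite !mulr1 -(knotS c (Ordinal km)) /= (IH (ltnW km)) => E.
  by rewrite (knotS p (Ordinal km)) -[LHS](subrKC (knot p k)) E.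
split=> // i t t01.
have t'01 := flip_itv (eps i) t01.
rewrite phiE -[LHS](subrK (g (knot c i))) cell // flipK g_knot; last exact: ltnW.
by rewrite phiE addrC.
Qed.

Lemma is_time_change_of_time_change g : time_change c p eps g -> is_time_change c lam eps s g.
Proof.
move=> gT; have [gm g0 g1 gphi] := gT.
have p0 i : 0 <= p i by exact: powR_ge0.
split=> // [t t01|]; first exact: monotone_onto_itv (time_change_onto gT) t01.
exists (fun i (v : 'rV[R]_1) => const_mx (phi p eps i (v ord0 ord0))).
have inE (e : bool) : pt_in R 1 e ord0 ord0 = flip e 0.
  by rewrite pt_inE; case: e; rewrite !mxE /flip /= ?subr0.
have outE (e : bool) : pt_out R 1 e ord0 ord0 = flip e 1.
  by rewrite pt_outE; case: e; rewrite !mxE /flip /= ?subrr.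
split=> //.
- move=> i; split; first exact: powR_ratio_itv.
  move=> x y; rewrite !enorm_rV1 !mxE !phiE.
  by rewrite opprD addrACA subrr add0r -mulrBr normrM flip_dist ger0_norm.
- move=> i i0; rewrite inE phi_flip mulr0 addr0 i0 knot0.
  by apply/rowP => j; rewrite !mxE.
- move=> i im; rewrite outE phi_flip mulr1 -knotS im knot_max lam_sum.
  by apply/rowP => j; rewrite !mxE ord1.
- move=> i j ij; congr const_mx.
  by rewrite outE inE !phi_flip mulr1 mulr0 addr0 -knotS ij.
- apply: uniform_within_continuous => e e0.
  have [delta d0 gd] := time_change_uniform c_gt0 c_sum powR_ratio_itv lam_sum gT e0.
  exists delta => // t u t0 tu u1 tud.
  apply: le_lt_trans (mx_norm_le_enorm _) _; rewrite enorm_vec1.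
  by rewrite ger0_norm ?subr_ge0; [exact: gd | exact: gm].
- move=> i t /pieceP[x x01 ->]; rewrite phiK ?gt_eqF //.
  by apply/rowP => j; rewrite !mxE gphi.
Qed.

End ScalarForm.

(** * The generalized inverse of the time change *)

Section TimeChangeInverse.
Variables (R : realType) (m : nat) (c p : 'I_m -> R) (eps : 'I_m -> bool).
Hypotheses (c_gt0 : forall i, 0 < c i) (c_sum : \sum_i c i = 1).
Hypotheses (p01 : forall i, 0 <= p i < 1) (p_sum : \sum_i p i = 1).
Variable g : R -> R.
Hypothesis gT : time_change c p eps g.

Lemma left_inv_itv y : 0 <= y <= 1 -> 0 <= left_inv g y <= 1.
Proof.
move=> /andP[y0 y1].
have lb0 : lbound [set t | 0 <= t <= 1 /\ y <= g t] 0 by move=> t [/andP[]].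
have in1 : [set t | 0 <= t <= 1 /\ y <= g t] 1.
  by rewrite /= (tc_1 gT) lexx ler01.
apply/andP; split; first by apply: lb_le_inf => //; exists 1.
by apply: ge_inf => //; exists 0.
Qed.

Lemma time_change_left_inv y : 0 <= y <= 1 -> g (left_inv g y) = y.
Proof.
move=> y01; have [gm g0 g1 _] := gT.
have /andP[l0 l1] := left_inv_itv y01.
have left_inv_le t : 0 <= t <= 1 -> y <= g t -> left_inv g y <= t.
  by move=> t01 yt; apply: ge_inf; [exists 0 => u [/andP[]] | split].
set A := [set t | 0 <= t <= 1 /\ y <= g t].
have lb0 : lbound A 0 by move=> t [/andP[]].
have in1 : A 1 by rewrite /A /= g1 lexx ler01; case/andP: y01.
apply/le_anti/andP; split.
  have g_cont : {within `[0, 1], continuous g}.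
    apply: uniform_within_continuous => e e0.
    have [delta d0 gd] := time_change_uniform c_gt0 c_sum p01 p_sum gT e0.
    exists delta => // t u t0 tu u1 tud.
    by rewrite ger0_norm ?subr_ge0; [exact: gd | exact: gm].
  have y_between : Num.min (g 0) (g 1) <= y <= Num.max (g 0) (g 1).
    by rewrite g0 g1 minEle maxEle ler01.
  have [t] := IVT ler01 g_cont y_between.
  rewrite in_itv /= => t01 gt; have /andP[t0 t1] := t01.
  by rewrite -[leRHS]gt; apply: gm => //; apply: left_inv_le; rewrite ?gt.
rewrite leNgt; apply/negP => ly.
(* Otherwise points arbitrarily close to the infimum would have values at least y, a jump excluded
   by uniform continuity. *)
have e0 : 0 < y - g (left_inv g y) by rewrite subr_gt0.
have [delta d0 gd] := time_change_uniform c_gt0 c_sum p01 p_sum gT e0.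
have hinf : has_inf A by split; [exists 1 | exists 0].
have [t [t01 yt] tl] := inf_adherent d0 hinf.
have lt : left_inv g y <= t by exact: left_inv_le.
have /andP[t0 t1] := t01.
have : g t - g (left_inv g y) < y - g (left_inv g y).
  by apply: gd => //; rewrite ltrBlDl.
by rewrite ltrD2r ltNge yt.
Qed.

End TimeChangeInverse.

(** * Hölder exponents *)

Section HolderExponent.
Variables (R : realType) (d : nat).
Implicit Types u : R -> 'rV[R]_d.

Lemma coord_bound_enorm (v : 'rV[R]_d) (B : R) : 0 <= B -> (forall i, `|v ord0 i| <= B) ->
  enorm v <= d%:R * B.
Proof.
move=> B0 vB; apply: le_trans (enorm_le_mx_norm v) _; rewrite ler_wpM2l //.
rewrite [leLHS]mx_normrE; apply: bigmax_le => // -[i j] _ /=.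
by rewrite ord1.
Qed.

Lemma poly_leading_bound (q : {poly R}) k : (forall j, (j < k)%N -> q`_j = 0) ->
  exists2 L, 0 <= L & forall x, `|x| <= 1 -> `|q.[x] - q`_k * x ^+ k| <= L * `|x| ^+ k.+1.
Proof.
move=> qk; pose w := drop_poly k.+1 q.
have qE : q = (q`_k)%:P * 'X^k + w * 'X^(k.+1).
  rewrite -{1}(poly_take_drop k.+1 q); congr (_ + _); apply/polyP => j.
  rewrite coef_take_poly coefCM coefXn ltnS leq_eqVlt.
  have [->|jk] := eqVneq j k; first by rewrite mulr1.
  by rewrite mulr0 /=; case: ifP => // /qk.
exists (\sum_(i < size w) `|w`_i|) => [|x x1]; first by apply: sumr_ge0.
rewrite {1}qE !hornerE /= addrC addKr normrM normrX ler_wpM2r ?exprn_ge0 //.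
rewrite horner_coef (le_trans (ler_norm_sum _ _ _)) // ler_sum // => i _.
by rewrite normrM normrX ler_piMr // exprn_ile1.
Qed.

(** Evaluation at t = t0, where the right-hand side is 0 because alpha is positive. *)
Lemma holder_at_center u alpha t0 (C : R) (P : 'I_d -> {poly R}) : 0 < alpha -> 0 < t0 < 1 ->
  (forall t, 0 < t < 1 ->
    enorm (u t - \row_(i < d) (P i).[t - t0]) <= C * `|t - t0| `^ alpha) ->
  u t0 = \row_(i < d) (P i).[0].
Proof.
move=> a0 t01 /(_ _ t01); rewrite subrr normr0 powR0 ?gt_eqF // mulr0 => h.
by apply: enormB_eq0; apply/le_anti; rewrite h enorm_ge0.
Qed.

Lemma norm_sub_itv_le1 (t t0 : R) : 0 < t < 1 -> 0 < t0 < 1 -> `|t - t0| <= 1.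
Proof. by move=> t1 t01; rewrite ler_norml; lra. Qed.

Lemma powR_anti (x a b : R) : 0 <= x <= 1 -> 0 < a -> a <= b -> x `^ b <= x `^ a.
Proof.
move=> /andP[x0 x1] a0 ab; have [->|xn0] := eqVneq x 0.
  by rewrite !powR0 // gt_eqF // (lt_le_trans a0).
by apply: ger_powR ab; rewrite lt0r xn0 x0.
Qed.

(* If the coefficients of degrees 1, ..., k.-1 vanish, the Taylor polynomial may be
   truncated at degree k. *)
Lemma holder_at_truncate u alpha t0 (C : R) (P : 'I_d -> {poly R}) k :
  0 < alpha -> 0 < t0 < 1 ->
  (forall t, 0 < t < 1 ->
    enorm (u t - \row_(i < d) (P i).[t - t0]) <= C * `|t - t0| `^ alpha) ->
  (forall i j, (0 < j < k)%N -> (P i)`_j = 0) ->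
  exists M, forall t, 0 < t < 1 ->
    enorm (u t - u t0 - (t - t0) ^+ k *: \row_(i < d) (P i - (P i).[0]%:P)`_k) <=
    M * `|t - t0| `^ Num.min alpha k.+1%:R.
Proof.
move=> a0 t01 uP Pk; have ut0 := holder_at_center a0 t01 uP.
(* Without its constant term the polynomial has no coefficient below degree k; for k = 0 the
   coefficient retained is itself 0. *)
pose q i := P i - (P i).[0]%:P.
have qk i j : (j < k)%N -> (q i)`_j = 0.
  move=> jk; rewrite /q coefB coefC; case: j jk => [|j] jk /=.
    by rewrite horner_coef0 subrr.
  by rewrite subr0 Pk.
have /choice[L LP] i : exists L, 0 <= L /\ forall x, `|x| <= 1 ->
    `|(q i).[x] - (q i)`_k * x ^+ k| <= L * `|x| ^+ k.+1.
  by have [L L0 hL] := poly_leading_bound (qk i); exists L.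
pose B := \sum_i L i.
have B0 : 0 <= B by apply: sumr_ge0 => i _; case: (LP i).
have LB i : L i <= B.
  by rewrite /B (bigD1 i) //= lerDl sumr_ge0 // => j _; case: (LP j).
exists (Num.max C 0 + d%:R * B) => t t1; set x := t - t0.
have x1 : `|x| <= 1 by exact: norm_sub_itv_le1.
have x01 : 0 <= `|x| <= 1 by rewrite normr_ge0.
have k0 : 0 < k.+1%:R :> R by rewrite ltr0Sn.
have min0 : 0 < Num.min alpha k.+1%:R by rewrite lt_min a0.
have h1 : `|x| `^ alpha <= `|x| `^ Num.min alpha k.+1%:R.
  by apply: powR_anti => //; rewrite ge_min lexx.
have h2 : `|x| ^+ k.+1 <= `|x| `^ Num.min alpha k.+1%:R.
  by rewrite -powR_mulrn //; apply: powR_anti => //; rewrite ge_min lexx orbT.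
set v := _ *: _.
rewrite ut0.
have -> : u t - \row_i (P i).[0] - v =
    (u t - \row_i (P i).[x]) + (\row_i (q i).[x] - v).
  by apply/rowP => i; clearbody v; rewrite !mxE /q hornerD hornerN hornerC; ring.
apply: le_trans (ler_enormD _ _) _; rewrite mulrDl lerD //.
  apply: le_trans (uP _ t1) _; apply: (@le_trans _ _ (Num.max C 0 * `|x| `^ alpha)).
    by rewrite ler_wpM2r ?powR_ge0 // le_max lexx.
  by rewrite ler_wpM2l // le_max lexx orbT.
rewrite -mulrA; apply: coord_bound_enorm; first by rewrite mulr_ge0 ?powR_ge0.
move=> i; rewrite !mxE -/(q i) mulrC; have [Li0 hL] := LP i.
by apply: le_trans (hL _ x1) _; rewrite ler_pM ?exprn_ge0.
Qed.

(** Truncation at k = 0, where the retained term is zero. The cap at 1 is due to a possible linear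
    Taylor term. *)
Lemma nd_holder_of_holder u alpha t0 : 0 < alpha -> 0 < t0 < 1 ->
  holder_at u alpha t0 -> nd_holder_at u (Num.min alpha 1) t0.
Proof.
move=> a0 t01 [C [P [_ uP]]].
have [|M hM] := holder_at_truncate (k := 0) a0 t01 uP; first by move=> i [].
exists M => t t1; have := hM t t1.
rewrite (_ : \row_i _ = 0) ?scaler0 ?subr0 //.
by apply/rowP => i; rewrite !mxE coefB coefC horner_coef0 subrr.
Qed.

Lemma holder_of_nd_holder u alpha t0 : 0 < alpha ->
  nd_holder_at u alpha t0 -> holder_at u alpha t0.
Proof.
move=> a0 [C hC]; exists C, (fun i => (u t0 ord0 i)%:P); split=> [i|t t1].
  by rewrite size_polyC; case: (_ != 0).
rewrite (_ : \row_i _ = u t0); first exact: hC.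
by apply/rowP => i; rewrite mxE hornerC.
Qed.

End HolderExponent.

Lemma ereal_sup_rescale (R : realType) (s : R) (P Q : R -> Prop) : 0 < s ->
  (forall a, 0 < a -> P (s * a) <-> Q a) ->
  ereal_sup [set a%:E | a in [set a : R | 0 < a /\ P a]] =
  (s%:E * ereal_sup [set a%:E | a in [set a : R | (0 < a)%R /\ Q a]])%E.
Proof.
move=> s0 PQ; rewrite -ereal_sup_pZl //; congr ereal_sup; apply/seteqP; split => x.
  move=> [a [a0 Pa] <-]; exists (a / s)%:E.
    exists (a / s) => //; split; first exact: divr_gt0.
    by apply/PQ; [exact: divr_gt0 | rewrite mulrC divfK // gt_eqF].
  by rewrite -EFinM mulrC divfK // gt_eqF.
move=> [_ [a [a0 Qa] <-] <-]; exists (s * a) => //.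
by split; [exact: mulr_gt0 | exact/PQ].
Qed.

Lemma ereal_rescale_eq (R : realType) (s a : R) (x : \bar R) : 0 < s ->
  (s%:E * x = a%:E)%E <-> x = (a / s)%:E.
Proof.
move=> s0; case: x => [r| |]; last 2 first.
- by rewrite gt0_muley ?lte_fin.
- by rewrite gt0_muleNy ?lte_fin.
rewrite -EFinM; split => [[<-]|[->]]; first by rewrite mulrAC divff ?mul1r // gt_eqF.
by rewrite mulrC divfK // gt_eqF.
Qed.

(** * Factorization through the time change *)

Section Conjugacy.
Variables (R : realType) (d m : nat) (c lam : 'I_m -> R) (eps : 'I_m -> bool).
Variables (S : 'I_m -> 'rV[R]_d -> 'rV[R]_d) (f : R -> 'rV[R]_d) (s : R) (g : R -> R).
Hypothesis fS : of_form_star_with c lam eps S f.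
Hypotheses (s_ge1 : 1 <= s) (lam_sum : \sum_i lam i `^ s = 1).

Let p i := lam i `^ s.

Hypothesis gT : time_change c p eps g.

Let c_gt0 := fs_c_gt0 fS.
Let c_sum := fs_c_sum fS.
Let lam01 i : 0 <= lam i < 1 := form_lam_itv i fS.
Let s_gt0 : 0 < s := lt_le_trans ltr01 s_ge1.
Let p01 i : 0 <= p i < 1 := powR_ratio_itv lam01 s_gt0 i.
Let p_ge0 i : 0 <= p i. Proof. exact: powR_ge0. Qed.
Let gM := time_change_onto gT.
Let g_mono := tc_mono gT.
Let g_itv t : 0 <= t <= 1 -> 0 <= g t <= 1 := @monotone_onto_itv _ g t gM.
Let sV_gt0 : 0 < s^-1. Proof. by rewrite invr_gt0. Qed.

Lemma powR_sK x : 0 <= x -> (x `^ s) `^ s^-1 = x.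
Proof. by move=> x0; rewrite -powRrM divff ?gt_eqF // powRr1. Qed.

Lemma powR_sVK x : 0 <= x -> (x `^ s^-1) `^ s = x.
Proof. by move=> x0; rewrite -powRrM mulVf ?gt_eqF // powRr1. Qed.

Lemma ler_powR_sV x y : 0 <= x -> x <= y -> x `^ s^-1 <= y `^ s^-1.
Proof. by move=> x0 xy; apply: ge0_ler_powR; rewrite ?nnegrE ?(ltW sV_gt0) ?(le_trans x0). Qed.

(** The power 1/s turns the ratios lam_i^s back into lam_i, and it is subadditive because s >= 1. *)
Lemma gauge_time_change : gauge c lam eps (fun t u => (g u - g t) `^ s^-1).
Proof.
split.
- by move=> t; rewrite subrr powR0 // gt_eqF.
- by rewrite (tc_1 gT) (tc_0 gT) subr0 powR_gt0.
- move=> t t' u' u t0 tt' t'u' u'u u1.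
  apply: ler_powR_sV.
    by rewrite subr_ge0; apply: g_mono => //; lra.
  by apply: lerB; apply: g_mono; lra.
- move=> t u v t0 tu uv v1.
  have -> : g v - g t = (g u - g t) + (g v - g u) by ring.
  apply: powR_subadditive; first by rewrite sV_gt0 /= invf_le1.
    by rewrite subr_ge0; apply: g_mono; lra.
  by rewrite subr_ge0; apply: g_mono; lra.
- move=> i x y x0 xy y1.
  rewrite !(time_change_cell _ gT); [|lra|lra].
  rewrite opprD addrACA subrr add0r -mulrBr.
  have -> : (if eps i then (g (1 - x) - g (1 - y)) `^ s^-1 else (g y - g x) `^ s^-1) =
      (flip (eps i) (g (flip (eps i) y)) - flip (eps i) (g (flip (eps i) x))) `^ s^-1.
    by rewrite /flip; case: (eps i) => //; congr (_ `^ _); ring.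
  rewrite powRM //; last by rewrite subr_ge0 monotone_onto_flip.
  by rewrite powR_sK //; case/andP: (lam01 i).
Qed.

(* On every interval the oscillation of f is comparable with the 1/s-th power of the
   increment of g. *)
Lemma osc_comparison : exists2 K, 0 < K &
  (forall t u, 0 <= t <= 1 -> 0 <= u <= 1 -> enorm (f u - f t) <= K * `|g u - g t| `^ s^-1) /\
  (forall t u M, 0 <= t -> t <= u -> u <= 1 ->
    (forall x y, t <= x <= u -> t <= y <= u -> enorm (f x - f y) <= M) ->
    (g u - g t) `^ s^-1 <= K * M).
Proof.
have f_bnd := form_bounded fS.
have gO : gauge c lam eps (osc f).
  apply: (gauge_osc f_bnd c_gt0 c_sum lam01 (form_unit fS)) => i x y.
  exact: (form_scaling i fS).
have [K1 K10 h1] := gauge_comparison c_gt0 c_sum lam01 gO gauge_time_change.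
have [K2 K20 h2] := gauge_comparison c_gt0 c_sum lam01 gauge_time_change gO.
exists (K1 + K2); first exact: addr_gt0.
split.
- have key t u : 0 <= t -> t <= u -> u <= 1 ->
      enorm (f u - f t) <= (K1 + K2) * `|g u - g t| `^ s^-1.
    move=> t0 tu u1; apply: (@le_trans _ _ (osc f t u)).
      by apply: le_osc => //; rewrite lexx tu.
    apply: (le_trans (h1 _ _ t0 tu u1)).
    rewrite ger0_norm ?subr_ge0; last exact: g_mono.
    by rewrite ler_wpM2r ?powR_ge0 // lerDl ltW.
  move=> t u /andP[t0 t1] /andP[u0 u1]; case: (leP t u) => tu; first exact: key.
  by rewrite enormB distrC; apply: key => //; exact: ltW.
- move=> t u M t0 tu u1 hM; apply: (le_trans (h2 _ _ t0 tu u1)).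
  have oM : osc f t u <= M by exact: osc_le.
  have M0 : 0 <= M by apply: le_trans (hM t t _ _); rewrite ?enorm_ge0 ?lexx.
  apply: (@le_trans _ _ (K2 * M)); first by rewrite ler_wpM2l // ltW.
  by rewrite ler_wpM2r // lerDr ltW.
Qed.

(** From g to f the upper comparison suffices. Conversely, the bound on f holds at all points
    between t0 and t, so it controls an oscillation, which the lower comparison turns into a bound
    on the increment of g. *)
Lemma nd_holder_time_change (alpha t0 : R) : 0 < alpha -> 0 < t0 < 1 ->
  nd_holder_at (vec1 g) (s * alpha) t0 <-> nd_holder_at f alpha t0.
Proof.
move=> a0 t01; have [K K0 [up low]] := osc_comparison; split.
- move=> [C hC]; exists (K * Num.max C 0 `^ s^-1) => t t1.
  apply: (le_trans (up _ _ _ _)); [lra|lra|].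
  have := hC t t1; rewrite enorm_vec1 => h.
  rewrite -mulrA ler_wpM2l ?(ltW K0) //.
  have M0 : 0 <= Num.max C 0 by rewrite le_max lexx orbT.
  apply: (@le_trans _ _ ((Num.max C 0 * `|t - t0| `^ (s * alpha)) `^ s^-1)).
    apply: ler_powR_sV => //; apply: le_trans h _.
    by rewrite ler_wpM2r ?powR_ge0 // le_max lexx.
  rewrite powRM ?powR_ge0 // -[X in _ * X]powRrM mulrAC divff ?gt_eqF //.
  by rewrite mul1r.
- move=> [C hC]; pose M := Num.max C 0.
  have M0 : 0 <= M by rewrite le_max lexx orbT.
  have key a b t : 0 < a -> a <= b -> b < 1 ->
      (forall x, a <= x <= b -> `|x - t0| <= `|t - t0|) ->
      g b - g a <= (K * (M + M)) `^ s * `|t - t0| `^ (s * alpha).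
    move=> a0' ab b1 hx.
    have := low a b ((M + M) * `|t - t0| `^ alpha) (ltW a0') ab (ltW b1).
    have hM x : a <= x <= b -> enorm (f x - f t0) <= M * `|t - t0| `^ alpha.
      move=> xab; apply: le_trans (hC x _) _; first lra.
      apply: (@le_trans _ _ (M * `|x - t0| `^ alpha)).
        by rewrite ler_wpM2r ?powR_ge0 // le_max lexx.
      rewrite ler_wpM2l //; apply: ge0_ler_powR; rewrite ?nnegrE ?(ltW a0) //.
      exact: hx.
    move=> low_ab.
    have h' : (g b - g a) `^ s^-1 <= K * ((M + M) * `|t - t0| `^ alpha).
      apply: low_ab => x y xab yab; apply: le_trans (ler_enorm_dist (f t0) _ _) _.
      by rewrite mulrDl lerD ?hM // enormB hM.
    have gab : 0 <= g b - g a by rewrite subr_ge0 g_mono // ltW.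
    rewrite -(powR_sVK gab).
    apply: (@le_trans _ _ ((K * ((M + M) * `|t - t0| `^ alpha)) `^ s)).
      apply: ge0_ler_powR; rewrite ?nnegrE ?powR_ge0 ?(ltW s_gt0) //.
      exact: le_trans (powR_ge0 _ _) h'.
    by rewrite mulrA powRM ?powR_ge0 ?mulr_ge0 ?addr_ge0 ?(ltW K0) // -powRrM [alpha * s]mulrC.
  exists ((K * (M + M)) `^ s) => t t1; rewrite enorm_vec1.
  case: (leP t t0) => tt0.
    rewrite ler0_norm ?opprB; last by rewrite subr_le0; apply: g_mono; lra.
    apply: key; [lra|lra|lra|].
    by move=> x xt; rewrite !ler0_norm; lra.
  rewrite ger0_norm; last by rewrite subr_ge0; apply: g_mono; lra.
  apply: key; [lra|lra|lra|].
  by move=> x xt; rewrite !ger0_norm; lra.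
Qed.

Lemma nd_exponent_time_change t : 0 < t < 1 ->
  nd_holder_exponent (vec1 g) t = (s%:E * nd_holder_exponent f t)%E.
Proof. by move=> t01; apply: ereal_sup_rescale => // a a0; exact: nd_holder_time_change. Qed.

Let h y := f (left_inv g y).

(** The points t and [left_inv g (g t)] have the same value under g, hence under f by the upper
    comparison: plateaus of g are plateaus of f. *)
Lemma left_inv_factor t : 0 <= t <= 1 -> f t = h (g t).
Proof.
move=> t01; have [K K0 [up _]] := osc_comparison.
have l01 := left_inv_itv gT (g_itv t01).
apply: enormB_eq0; apply/le_anti; rewrite enorm_ge0 andbT.
apply: le_trans (up _ _ l01 t01) _.
rewrite (time_change_left_inv c_gt0 c_sum p01 lam_sum gT (g_itv t01)).
by rewrite subrr normr0 powR0 ?mulr0 // gt_eqF.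
Qed.

Lemma factor_comparison : exists2 K, 0 < K &
  (forall y z, 0 <= y <= 1 -> 0 <= z <= 1 -> enorm (h z - h y) <= K * `|z - y| `^ s^-1) /\
  (forall y z M, 0 <= y -> y <= z -> z <= 1 ->
    (forall v w, y <= v <= z -> y <= w <= z -> enorm (h v - h w) <= M) ->
    (z - y) `^ s^-1 <= K * M).
Proof.
have [K K0 [up low]] := osc_comparison; exists K => //; split.
  move=> y z y01 z01.
  have := up _ _ (left_inv_itv gT y01) (left_inv_itv gT z01).
  by rewrite !(time_change_left_inv c_gt0 c_sum p01 lam_sum gT).
move=> y z M y0 yz z1 hM.
have y01 : 0 <= y <= 1 by lra.
have z01 : 0 <= z <= 1 by lra.
have gy := time_change_left_inv c_gt0 c_sum p01 lam_sum gT y01.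
have gz := time_change_left_inv c_gt0 c_sum p01 lam_sum gT z01.
have /andP[ly0 ly1] := left_inv_itv gT y01.
have /andP[lz0 lz1] := left_inv_itv gT z01.
have M0 : 0 <= M by apply: le_trans (hM y y _ _); rewrite ?enorm_ge0 ?lexx.
(* Preimages in the opposite order would force z = y by monotonicity of g. *)
case: (leP (left_inv g y) (left_inv g z)) => lyz; last first.
  have := g_mono lz0 (ltW lyz) ly1; rewrite gy gz => zy.
  rewrite (_ : z - y = 0) ?powR0 ?gt_eqF //; last by lra.
  by rewrite mulr_ge0 // ltW.
rewrite -{1}gz -{1}gy; apply: low => // v w /andP[v1 v2] /andP[w1 w2].
have v01 : 0 <= v <= 1 by lra.
have w01 : 0 <= w <= 1 by lra.
rewrite !left_inv_factor //; apply: hM; rewrite -{1}gy -{1}gz.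
  by apply/andP; split; apply: g_mono => //; lra.
by apply/andP; split; apply: g_mono => //; lra.
Qed.

(** Since s > 1, an exponent above 1/s remains above 1/s when capped at 1. Polynomial corrections
    therefore cannot help, and the lower comparison near y excludes such an exponent. *)
Lemma factor_exponent y : 1 < s -> 0 < y < 1 -> holder_exponent h y = (s^-1)%:E.
Proof.
move=> s1 y01; have [K K0 [up low]] := factor_comparison.
apply/le_anti/andP; split; last first.
  apply: ereal_sup_ubound; exists s^-1 => //; split => //.
  apply: holder_of_nd_holder => //; exists K => t t01; apply: up; lra.
apply: ge_ereal_sup => _ [a [a0 ha] <-]; rewrite lee_fin leNgt; apply/negP => sa.
have [C hC] := nd_holder_of_holder a0 y01 ha.
set b := Num.min a 1 in hC.
have sb : s^-1 < b by rewrite lt_min sa invf_lt1.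
have b0 : 0 < b := lt_trans sV_gt0 sb.
pose M := K * (Num.max C 1 + Num.max C 1).
have C1 : 1 <= Num.max C 1 by rewrite le_max lexx orbT.
have M0 : 0 < M by rewrite mulr_gt0 // addr_gt0 // (lt_le_trans ltr01).
have key v : 0 < v -> v < 1 - y -> 1 <= M * v `^ (b - s^-1).
  move=> v0 v1.
  have hv : (y + v - y) `^ s^-1 <= K * ((Num.max C 1 + Num.max C 1) * v `^ b).
    apply: low; [lra|lra|lra|] => x z xy zy.
    have hx w : y <= w <= y + v -> enorm (h w - h y) <= Num.max C 1 * v `^ b.
      move=> wy; apply: le_trans (hC w _) _; first lra.
      apply: (@le_trans _ _ (Num.max C 1 * `|w - y| `^ b)).
        by rewrite ler_wpM2r ?powR_ge0 // le_max lexx.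
      rewrite ler_wpM2l ?(le_trans ler01) //; apply: ge0_ler_powR; rewrite ?nnegrE ?(ltW b0) ?(ltW v0) //.
      by rewrite ger0_norm; lra.
    apply: le_trans (ler_enorm_dist (h y) _ _) _.
    by rewrite mulrDl lerD ?hx // enormB hx.
  move: hv; rewrite addrAC subrr add0r mulrA -/M.
  have -> : v `^ b = v `^ (b - s^-1) * v `^ s^-1.
    by rewrite -powRD ?subrK // (gt_eqF v0) implybT.
  by rewrite mulrA ler_pMl // powR_gt0.
pose q := b - s^-1.
have q0 : 0 < q by rewrite subr_gt0.
have e0 : 0 < (2 * M)^-1 by rewrite invr_gt0 mulr_gt0.
(* Chosen so that M v^q is at most 1/2 while y + v stays below 1. *)
pose v := Num.min ((1 - y) / 2) ((2 * M)^-1 `^ q^-1).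
have v0 : 0 < v by rewrite lt_min powR_gt0 // andbT; lra.
have v1 : v < 1 - y by rewrite gt_min; apply/orP; left; lra.
have := key v v0 v1; rewrite leNgt => /negP; apply.
apply: (@le_lt_trans _ _ (M * (2 * M)^-1)); last first.
  by rewrite invfM mulrCA divff ?gt_eqF // mulr1 invf_lt1 // ltr1n.
rewrite ler_wpM2l ?(ltW M0) //.
rewrite -[leRHS](_ : ((2 * M)^-1 `^ q^-1) `^ q = _); last first.
  by rewrite -powRrM mulVf ?gt_eqF // powRr1 // ltW.
apply: ge0_ler_powR; rewrite ?nnegrE ?powR_ge0 ?(ltW q0) ?(ltW v0) //.
by rewrite ge_min lexx orbT.
Qed.

End Conjugacy.

(** * Removal of the pieces of ratio zero *)

Section NonzeroIndices.
Variables (R : realType) (m : nat) (lam : 'I_m -> R).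

Let N := #|[pred k : 'I_m | 0 < lam k]|.
Let j : 'I_N -> 'I_m := nonzero_index (lam := lam).

Lemma nonzero_index_gt0 i : 0 < lam (j i).
Proof. by have := enum_valP i; rewrite inE. Qed.

Lemma nonzero_index_lt (i l : 'I_N) : (i < l)%N -> (j i < j l)%N.
Proof.
move=> il; rewrite /j /nonzero_index.
have x0 : 'I_m by exact: enum_val i.
have ltn_s : sorted ltn [seq val k | k <- enum [pred k : 'I_m | 0 < lam k]].
  apply: (@subseq_sorted _ ltn ltn_trans _ (iota 0 m)); last exact: iota_ltn_sorted.
  by rewrite -val_enum_ord; apply: map_subseq; rewrite enumT; exact: filter_subseq.
rewrite !(enum_val_nth x0) -!(nth_map x0 0%N val) -?cardE ?ltn_ord //.
apply: (sorted_ltn_nth ltn_trans) => //; rewrite inE size_map -cardE; exact: ltn_ord.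
Qed.

Lemma nonzero_index_ltE (i l : 'I_N) : (j l < j i)%N = (l < i)%N.
Proof.
case: (ltngtP l i) => h; first by rewrite nonzero_index_lt.
  by apply/negbTE; rewrite -leqNgt ltnW // nonzero_index_lt.
by rewrite (val_inj h) ltnn.
Qed.

Lemma big_nonzero_index (F : 'I_m -> R) (P : pred 'I_m) :
  (forall k, lam k <= 0 -> F k = 0) ->
  \sum_(k | P k) F k = \sum_(i < N | P (j i)) F (j i).
Proof.
move=> F0; rewrite -(big_enum_val_cond (A := [pred k : 'I_m | 0 < lam k]) P F).
rewrite big_mkcond [RHS]big_mkcond /=; apply: eq_bigr => k _.
rewrite !inE; case: ltrP => //= /F0 ->; by rewrite if_same.
Qed.

End NonzeroIndices.

Lemma num_pieces_ge2 (R : realType) (n : nat) (q : 'I_n -> R) :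
  (forall i, q i < 1) -> \sum_i q i = 1 -> (2 <= n)%N.
Proof.
case: n q => [|[|n]] // q q1 /eqP; first by rewrite big_ord0 eq_sym oner_eq0.
by rewrite big_ord1 lt_eqF.
Qed.

Section FactorForm.
Variables (R : realType) (d m : nat) (c lam : 'I_m -> R) (eps : 'I_m -> bool).
Variables (S : 'I_m -> 'rV[R]_d -> 'rV[R]_d) (f : R -> 'rV[R]_d) (s : R) (g : R -> R).
Hypothesis fS : of_form_star_with c lam eps S f.
Hypotheses (s_ge1 : 1 <= s) (lam_sum : \sum_i lam i `^ s = 1).
Hypothesis gT : time_change c (fun i => lam i `^ s) eps g.

Let p i := lam i `^ s.
Let h y := f (left_inv g y).
Let N := #|[pred k : 'I_m | 0 < lam k]|.
Let j : 'I_N -> 'I_m := nonzero_index (lam := lam).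
Let c_h i := p (j i).
Let c_gt0 := fs_c_gt0 fS.
Let c_sum := fs_c_sum fS.
Let c_ge0 i : 0 <= c i := ltW (c_gt0 i).
Let s_gt0 : 0 < s := lt_le_trans ltr01 s_ge1.
Let lam01 i : 0 <= lam i < 1 := form_lam_itv i fS.
Let p01 i : 0 <= p i < 1 := powR_ratio_itv lam01 s_gt0 i.
Let p_gt0 i : 0 < c_h i := powR_gt0 _ (nonzero_index_gt0 i).

Let p_dead k : lam k <= 0 -> p k = 0.
Proof.
move=> l0; rewrite /p (_ : lam k = 0) ?powR0 ?gt_eqF //.
by apply/le_anti; rewrite l0; case/andP: (lam01 k).
Qed.

(** A removed piece has length lam_k^s = 0 in the range, so removal does not move the division
    points. *)
Lemma knot_nonzero_index (i : 'I_N) : knot c_h i = knot p (j i).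
Proof.
rewrite /knot (big_nonzero_index _ p_dead); apply: eq_bigl => l.
by rewrite nonzero_index_ltE.
Qed.

Lemma knot_nonzero_indexS (i : 'I_N) : knot c_h i.+1 = knot p (j i).+1.
Proof. by rewrite !knotS knot_nonzero_index. Qed.

Lemma sum_nonzero_index : \sum_i c_h i = 1.
Proof. by rewrite -lam_sum (big_nonzero_index xpredT p_dead). Qed.

Lemma time_change_knot (i : 'I_m) : g (knot c i) = knot p i /\ g (knot c i.+1) = knot p i.+1.
Proof.
have knot01 e : 0 <= e <= 1 -> g (knot c i + c i * e) =
    knot p i + p i * flip (eps i) (g (flip (eps i) e)).
  exact: time_change_cell.
split.
  have := knot01 0; rewrite mulr0 addr0 => ->; last by rewrite lexx ler01.
  by rewrite /flip; case: (eps i); rewrite ?subr0 ?(tc_1 gT) ?(tc_0 gT) ?subrr mulr0 addr0.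
have := knot01 1; rewrite mulr1 -knotS => ->; last by rewrite lexx ler01.
rewrite knotS; congr (_ + _).
by rewrite /flip; case: (eps i); rewrite ?subrr ?(tc_1 gT) ?(tc_0 gT) ?subr0 mulr1.
Qed.

(** The chaining condition of f links consecutive pieces, but constant pieces may separate
    consecutive surviving ones. Expressing both ends as values of h at division points of the range
    bridges this gap, since the intermediate points coincide there. *)
Lemma similitude_ends (i : 'I_m) :
  S i (pt_in R d (eps i)) = h (knot p i) /\ S i (pt_out R d (eps i)) = h (knot p i.+1).
Proof.
have [f0 f1] := form_endpoints fS; have [g0 g1] := time_change_knot i.
have inE : f (flip (eps i) 0) = pt_in R d (eps i).
  by rewrite pt_inE /flip; case: (eps i); rewrite ?subr0.
have outE : f (flip (eps i) 1) = pt_out R d (eps i).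
  by rewrite pt_outE /flip; case: (eps i); rewrite ?subrr.
rewrite -g0 -g1 /h -!(left_inv_factor fS s_ge1 lam_sum gT) ?knot_itv //.
rewrite -inE -outE -!(form_phi _ fS) ?flip_itv ?lexx ?ler01 //.
by rewrite !phi_flip mulr0 addr0 mulr1 knotS.
Qed.

Lemma factor_form :
  of_form_star_with c_h (fun i => lam (j i)) (fun i => eps (j i)) (fun i => S (j i)) h.
Proof.
have h_g t : 0 <= t <= 1 -> h (g t) = f t.
  by move=> t01; rewrite /h -(left_inv_factor fS s_ge1 lam_sum gT).
have [f0 f1] := form_endpoints fS.
split.
- exact: fs_dim fS.
- by apply: (num_pieces_ge2 _ sum_nonzero_index) => i; case/andP: (p01 (j i)).
- by move=> i; exact: fs_simil fS _.
- move=> i i0; have [-> _] := similitude_ends (j i).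
  by rewrite -knot_nonzero_index i0 knot0 -(tc_0 gT) h_g ?lexx ?ler01.
- move=> i iN; have [_ ->] := similitude_ends (j i).
  rewrite -knot_nonzero_indexS iN knot_max sum_nonzero_index -(tc_1 gT) h_g //.
  by rewrite ?lexx ?ler01.
- move=> i l il; have [_ ->] := similitude_ends (j i); have [-> _] := similitude_ends (j l).
  by rewrite -knot_nonzero_indexS -knot_nonzero_index il.
- exact: p_gt0.
- exact: sum_nonzero_index.
- have [K K0 [up _]] := factor_comparison fS s_ge1 lam_sum gT.
  apply: uniform_within_continuous => e e0.
  (* Inverse of the modulus K delta^(1/s), halved for strictness. *)
  exists ((e / K / 2) `^ s) => [|y z y0 yz z1 yz_small].
    by rewrite powR_gt0 // !divr_gt0.
  apply: le_lt_trans (mx_norm_le_enorm _) _.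
  apply: le_lt_trans (up _ _ _ _) _; [lra|lra|].
  apply: (@le_lt_trans _ _ (K * (e / K / 2))).
    rewrite ler_wpM2l ?(ltW K0) //.
    rewrite -[leRHS](powR_sK s_ge1); last by rewrite !divr_ge0 // ltW.
    apply: ler_powR_sV => //.
    by rewrite ger0_norm ?subr_ge0 // ltW.
  by rewrite (_ : K * _ = e / 2); [lra | field; rewrite gt_eqF].
- move=> i _ /pieceP[x x01 ->]; rewrite phiK ?gt_eqF //.
  have l01 := left_inv_itv gT x01.
  (* Writing x as [g (left_inv g x)] lets the equation for h follow from the conjugacy of g and the
     equation of f. *)
  rewrite phiE knot_nonzero_index -[X in flip _ X](time_change_left_inv c_gt0 c_sum p01 lam_sum gT x01).
  rewrite -(phiE p) -(tc_conj gT) // h_g; last exact: phi_itv.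
  by rewrite (form_phi _ fS).
Qed.

End FactorForm.

(** * Absence of Taylor terms for uniform partitions *)

(** Take a cluster point of common zeros up to 1/(n + 1). Each index is treated separately at that
    point, so the family may be arbitrary. *)
Lemma compact_common_zero (R : realType) (I : Type) (F : I -> R -> R) :
  (forall i, continuous (F i)) ->
  (forall e : R, 0 < e -> exists2 z : R, 0 <= z <= 1 & forall i, `|F i z| <= e) ->
  exists2 z : R, 0 <= z <= 1 & forall i, F i z = 0.
Proof.
move=> F_cont approx.
have /choice[z zP] n : exists z : R, 0 <= z <= 1 /\ forall i, `|F i z| <= n.+1%:R^-1.
  by have [|z z01 zF] := approx n.+1%:R^-1; [rewrite invr_gt0 | exists z].
have z_in : (z @ \oo) `[0, 1]%classic.
  by exists 0%N => // n _ /=; rewrite in_itv /=; case: (zP n).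
have [z0 [z001 z0_cluster]] := @segment_compact R 0 1 _ _ z_in.
exists z0 => [|i]; first by move: z001; rewrite /= in_itv.
apply/eqP; rewrite -normr_le0; apply/ler_addgt0Pr => e e0; rewrite add0r.
have e20 : 0 < e / 2 by rewrite divr_gt0.
have near_z0 : nbhs z0 [set x | `|F i z0 - F i x| < e / 2].
  by have /cvgrPdist_lt /(_ _ e20) := F_cont i z0.
have [N N_small] : exists N, N.+1%:R^-1 < e / 2.
  have [N hN] := geometric_small 1 (r := 2^-1) (ltac:(lra)) e20.
  (* The index 2^N converts the geometric bound into one on the harmonic sequence. *)
  exists (2 ^ N)%N; apply: le_lt_trans hN; rewrite mul1r exprVn -natrX lef_pV2 ?posrE ?ltr0n ?expn_gt0 //.
  by rewrite ler_nat.
have tail : (z @ \oo) [set z n | n in [set n | (N <= n)%N]].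
  by exists N => // n /= Nn; exists n.
have [_ [[n /= Nn <-] zn]] := z0_cluster _ _ tail near_z0.
have [_ /(_ i) Fn] := zP n.
have small : n.+1%:R^-1 <= N.+1%:R^-1 :> R.
  by rewrite lef_pV2 ?posrE ?ltr0n // ler_nat.
have zn' : `|F i z0 - F i (z n)| < e / 2 := zn.
rewrite -(subrK (F i (z n)) (F i z0)); apply: le_trans (ler_normD _ _) _.
rewrite [e]splitr; apply: lerD; first exact: ltW.
exact: le_trans (Fn) (le_trans small (ltW N_small)).
Qed.

Lemma nearby_point (R : realType) (z t : R) : 0 <= z <= 1 -> 0 < t -> t <= 2^-1 ->
  exists2 x, 0 <= x <= 1 & `|x - z| = t.
Proof.
move=> /andP[z0 z1] t0 t_half; case: (leP z 2^-1) => h.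
  by exists (z + t); [lra | rewrite addrAC subrr add0r gtr0_norm].
by exists (z - t); [lra | rewrite addrAC subrr add0r normrN gtr0_norm].
Qed.

Section NoPolynomialPart.
Variables (R : realType) (d m : nat) (c lam : 'I_m -> R) (eps : 'I_m -> bool).
Variables (S : 'I_m -> 'rV[R]_d -> 'rV[R]_d) (u : R -> 'rV[R]_d).
Hypothesis uS : of_form_star_with c lam eps S u.
Hypotheses (c_unif : forall i, c i = m%:R^-1) (eps0 : forall i, eps i = false).
Hypothesis nondeg : nondegenerate_params c lam.

Let c_gt0 := fs_c_gt0 uS.
Let c_sum := fs_c_sum uS.
Let c_ge0 i : 0 <= c i := ltW (c_gt0 i).
Let lam01 i : 0 <= lam i < 1 := form_lam_itv i uS.
Let m_gt0 : 0 < m%:R :> R. Proof. by rewrite ltr0n (leq_trans _ (fs_num uS)). Qed.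
Let theta : R := m%:R^-1.
Let theta_gt0 : 0 < theta. Proof. by rewrite invr_gt0. Qed.
Let theta_lt1 : theta < 1.
Proof. by rewrite invf_lt1 // ltr1n (leq_trans _ (fs_num uS)). Qed.

Let phi_unif i x : phi c eps i x = knot c i + theta * x.
Proof. by rewrite phiE eps0 /flip c_unif. Qed.

(** Equal lengths and the absence of reversals make every composition of n maps a translate of x |->
    theta^n x; [rho] is the product of the ratios along the address of t0. *)
Lemma cylinder n t0 : 0 <= t0 <= 1 -> exists a x0 rho,
  [/\ 0 <= x0 <= 1, t0 = a + theta ^+ n * x0,
      (forall x, 0 <= x <= 1 -> 0 <= a + theta ^+ n * x <= 1), 0 <= rho &
      (forall x y, 0 <= x <= 1 -> 0 <= y <= 1 ->
        enorm (u (a + theta ^+ n * x) - u (a + theta ^+ n * y)) = rho * enorm (u x - u y))].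
Proof.
elim: n t0 => [|n IH] t0 t01.
  by exists 0, t0, 1; split=> // *; rewrite expr0 !add0r !mul1r.
have [a [x0 [rho [x01 tE a01 rho0 scaling]]]] := IH _ t01.
have [i [z z01 xE]] := phi_exists c_gt0 c_sum eps x01.
have E x : a + theta ^+ n * knot c i + theta ^+ n.+1 * x = a + theta ^+ n * phi c eps i x.
  by rewrite phi_unif exprSr; ring.
exists (a + theta ^+ n * knot c i), z, (rho * lam i); split => //.
- by rewrite E -xE.
- by move=> x x01'; rewrite E; apply: a01; exact: phi_itv.
- by rewrite mulr_ge0 //; case/andP: (lam01 i).
- move=> x y x01' y01'; rewrite !E scaling ?phi_itv //.
  by rewrite (form_scaling _ uS) // mulrA.
Qed.

Section Monomial.
Variables (k : nat) (beta M t0 : R) (a : 'rV[R]_d).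
Hypotheses (k_gt0 : (0 < k)%N) (k_beta : k%:R < beta) (t01 : 0 < t0 < 1).
Hypothesis expansion : forall t, 0 < t < 1 ->
  enorm (u t - u t0 - (t - t0) ^+ k *: a) <= M * `|t - t0| `^ beta.

Let D (z x y : R) : R := `|(x - z) ^+ k - (y - z) ^+ k|.

(* Zooming in on the cylinders around t0 turns the expansion into a statement about u on
   the whole of [0, 1]; comparing norms only, the unknown orthogonal parts disappear, and
   the unknown factor is D z 1 0 because |u 1 - u 0| = 1. *)
Lemma expansion_cylinder : enorm a != 0 -> forall e, 0 < e ->
  exists2 z, 0 <= z <= 1 & forall x y, 0 <= x <= 1 -> 0 <= y <= 1 ->
    `|D z 1 0 * enorm (u x - u y) - D z x y| <= e.
Proof.
move=> a_neq0 e e0.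
have a0 : 0 < enorm a by rewrite lt0r a_neq0 enorm_ge0.
have [B uB] := form_bounded uS.
have B0 : 0 <= B by apply: le_trans (uB 0 _); rewrite ?enorm_ge0 ?lexx ?ler01.
(* The size of the remainder relative to the monomial shrinks by this factor per generation; it is
   below 1 because beta > k. *)
pose ratio := theta `^ (beta - k%:R).
have ratio01 : 0 <= ratio < 1.
  rewrite powR_ge0 -[ltRHS](_ : 1 `^ (beta - k%:R) = 1); last by rewrite powR1.
  by rewrite gt0_ltr_powR ?subr_gt0 ?nnegrE ?ler01 // ltW.
pose M' := Num.max M 0.
have M0 : 0 <= M' by rewrite le_max lexx orbT.
(* Two expansions give the error (M' + M') / |a|; the factor B + B + 1 pays for replacing the
   unknown scale by [D z 1 0] in front of |u x - u y| <= B + B. *)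
have [n1 n1_small] := geometric_small ((M' + M') / enorm a * (B + B + 1)) ratio01 e0.
have /andP[t0_gt0 t0_lt1] := t01.
have margin : 0 < Num.min t0 (1 - t0) by rewrite lt_min t0_gt0 subr_gt0.
(* Keeps the whole cylinder around t0 inside (0, 1), where the expansion holds. *)
have [n2 n2_small] := geometric_small 1 (r := theta) (ltac:(by rewrite ltW)) margin.
pose n := maxn n1 n2; pose q := theta ^+ n.
have q0 : 0 < q by rewrite exprn_gt0.
have q_margin : q < Num.min t0 (1 - t0).
  apply: le_lt_trans n2_small; rewrite mul1r.
  by apply: ler_wiXn2l; rewrite ?ltW // leq_maxr.
have ratio_small : (M' + M') / enorm a * (B + B + 1) * ratio ^+ n <= e.
  apply: le_trans (ltW n1_small); rewrite ler_wpM2l //.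
    by rewrite mulr_ge0 ?divr_ge0 ?addr_ge0 ?ler01 ?enorm_ge0.
  by case/andP: ratio01 => r0 r1; apply: ler_wiXn2l => //; [exact: ltW | exact: leq_maxl].
have t01' : 0 <= t0 <= 1 by lra.
have [b [z [rho [z01 tE _ rho0 scaling]]]] := cylinder n t01'.
exists z => //.
pose psi x := b + q * x.
have psiE x : psi x - t0 = q * (x - z) by rewrite /psi tE -/q; ring.
have [qt qt'] : q < t0 /\ q < 1 - t0 by move: q_margin; rewrite lt_min => /andP[].
have dist01 x : 0 <= x <= 1 -> `|x - z| <= 1 by move=> x01; rewrite ler_norml; lra.
have psi01 x : 0 <= x <= 1 -> 0 < psi x < 1.
  move=> x01; have : `|psi x - t0| <= q.
    by rewrite psiE normrM (gtr0_norm q0) ler_piMr ?(ltW q0) ?dist01.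
  by rewrite ler_norml; lra.
have q_beta : q `^ beta = q ^+ k * ratio ^+ n.
  rewrite -powR_mulrn ?(ltW q0) // /q -!powR_mulrn ?powR_ge0 ?exprn_ge0 ?(ltW theta_gt0) //.
  rewrite /ratio -!powRrM -powRD ?(gt_eqF theta_gt0) ?implybT //; congr (_ `^ _); ring.
have step x : 0 <= x <= 1 ->
    enorm (u (psi x) - u t0 - (q * (x - z)) ^+ k *: a) <= M' * (q ^+ k * ratio ^+ n).
  move=> x01; rewrite -psiE; apply: le_trans (expansion (psi01 _ x01)) _.
  apply: (@le_trans _ _ (M' * `|psi x - t0| `^ beta)).
    by rewrite ler_wpM2r ?powR_ge0 // le_max lexx.
  rewrite ler_wpM2l // -q_beta; apply: ge0_ler_powR; rewrite ?nnegrE ?(ltW q0) //.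
    by rewrite (le_trans _ (ltW k_beta)).
  by rewrite psiE normrM (gtr0_norm q0) ler_piMr ?(ltW q0) ?dist01.
pose mu := rho / (enorm a * q ^+ k).
have mu_bound x y : 0 <= x <= 1 -> 0 <= y <= 1 ->
    `|mu * enorm (u x - u y) - D z x y| <= (M' + M') / enorm a * ratio ^+ n.
  move=> x01 y01.
  have A0 : 0 < enorm a * q ^+ k by rewrite mulr_gt0 // exprn_gt0.
  have : `|rho * enorm (u x - u y) - enorm a * q ^+ k * D z x y| <=
      (M' + M') * (q ^+ k * ratio ^+ n).
    rewrite -scaling // -/q -/(psi x) -/(psi y).
    have -> : enorm a * q ^+ k * D z x y =
        enorm (((q * (x - z)) ^+ k - (q * (y - z)) ^+ k) *: a).
      by rewrite enormZ !exprMn -mulrBr normrM /D (ger0_norm (exprn_ge0 _ (ltW q0))); ring.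
    apply: le_trans (ler_dist_enorm _ _) _; rewrite mulrDl.
    have -> : u (psi x) - u (psi y) - ((q * (x - z)) ^+ k - (q * (y - z)) ^+ k) *: a =
        (u (psi x) - u t0 - (q * (x - z)) ^+ k *: a) -
        (u (psi y) - u t0 - (q * (y - z)) ^+ k *: a).
      by apply/rowP => i; rewrite !mxE; ring.
    by apply: le_trans (ler_enormD _ _) _; rewrite enormN lerD ?step.
  have -> : rho * enorm (u x - u y) - enorm a * q ^+ k * D z x y =
      (enorm a * q ^+ k) * (mu * enorm (u x - u y) - D z x y).
    by rewrite /mu; field; rewrite a_neq0 expf_neq0 // gt_eqF.
  rewrite normrM (gtr0_norm A0) -ler_pdivlMl // => /le_trans; apply.
  rewrite le_eqVlt; apply/orP; left; apply/eqP; field.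
  by rewrite a_neq0 expf_neq0 // gt_eqF.
move=> x y x01 y01; set T := (M' + M') / enorm a * ratio ^+ n in mu_bound.
have h1 := mu_bound x y x01 y01.
have h2 := mu_bound 1 0 (ltac:(lra)) (ltac:(lra)); rewrite (form_unit uS) mulr1 in h2.
set V := enorm (u x - u y) in h1 *.
have V0 : 0 <= V by exact: enorm_ge0.
have VB : V <= B + B.
  by apply: le_trans (ler_enormD _ _) _; rewrite enormN lerD ?uB.
have T0 : 0 <= T by rewrite /T mulr_ge0 ?divr_ge0 ?addr_ge0 ?enorm_ge0 ?exprn_ge0 ?powR_ge0.
have -> : D z 1 0 * V - D z x y = (mu * V - D z x y) - (mu - D z 1 0) * V by ring.
apply: le_trans (ler_normB _ _) _; rewrite normrM (ger0_norm V0).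
have h3 : `|mu - D z 1 0| * V <= T * (B + B) by rewrite ler_pM.
apply: le_trans ratio_small.
have -> : (M' + M') / enorm a * (B + B + 1) * ratio ^+ n = T + T * (B + B).
  by rewrite /T; ring.
exact: lerD.
Qed.

Lemma monomial_vanishes : a = 0.
Proof.
apply: enorm_eq0; apply: contrapT => /eqP a0.
(* All pairs of points must share the same z, so the family is indexed by the unit square. *)
pose I : Type := {xy : R * R | 0 <= xy.1 <= 1 /\ 0 <= xy.2 <= 1}.
pose F (i : I) z := D z 1 0 * enorm (u (sval i).1 - u (sval i).2) - D z (sval i).1 (sval i).2.
have D_cont x y : continuous (fun z => D z x y).
  have pow_cont v : continuous (fun z : R => (v - z) ^+ k).
    move=> z; apply: (@continuous_comp _ _ _ (fun z => v - z) (fun w => w ^+ k)).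
      by apply: cvgB => //; exact: cvg_cst.
    exact: exprn_continuous.
  by move=> z; apply: cvg_norm; apply: cvgB; exact: pow_cont.
have [|e e0|z z01 Fz] := @compact_common_zero R I F.
- move=> i z; apply: cvgB; last exact: D_cont.
  by apply: cvgM; [exact: D_cont | exact: cvg_cst].
- have [z z01 zP] := expansion_cylinder a0 e0.
  by exists z => // -[[x y] [x01 y01]]; exact: zP.
have DE x y : 0 <= x <= 1 -> 0 <= y <= 1 -> D z 1 0 * enorm (u x - u y) = D z x y.
  by move=> x01 y01; have /subr0_eq := Fz (exist _ (x, y) (conj x01 y01)).
have D_scale i x y : 0 <= x <= 1 -> 0 <= y <= 1 ->
    D z (phi c eps i x) (phi c eps i y) = lam i * D z x y.
  by move=> x01 y01; rewrite -DE ?phi_itv // -(DE x y) // (form_scaling _ uS) // mulrCA.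
have [k1|k1] := eqVneq k 1%N.
  (* For k = 1 the pair (1, 0) gives lam_i = theta = c_i. *)
  apply: nondeg => i; have := D_scale i 1 0 (ltac:(lra)) (ltac:(lra)).
  rewrite /D k1 !expr1 !phi_unif mulr1 mulr0 addr0.
  rewrite (_ : _ - z - _ = theta); last by ring.
  by rewrite (_ : 1 - z - _ = 1) ?normr1 ?mulr1 ?gtr0_norm ?c_unif //; ring.
have k2 : (2 <= k)%N by rewrite ltn_neqAle eq_sym k1.
(* The gauge |(x - z)^k - (y - z)^k| scales under phi i; letting x tend to y = z compares
   a first-order term with one of order k. *)
have fixed i : phi c eps i z = z.
  pose W := phi c eps i z - z.
  (* The divided difference ((W + v)^k - W^k) / v as a polynomial in v; its value k W^(k-1) at 0
     vanishes only if W = 0, as k >= 2. *)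
  pose r : {poly R} := \sum_(l < k) ('X + W%:P) ^+ (k.-1 - l) * (W ^+ l)%:P.
  have rE v : r.[v] = \sum_(l < k) (W + v) ^+ (k.-1 - l) * W ^+ l.
    by rewrite horner_sum; apply: eq_bigr => l _; rewrite hornerM horner_exp hornerD hornerX !hornerC [v + W]addrC.
  have r0 : r.[0] = k%:R * W ^+ k.-1.
    rewrite rE (eq_bigr (fun _ => W ^+ k.-1)) => [|l _].
      by rewrite sumr_const card_ord mulr_natl.
    by rewrite addr0 -exprD subnK // -ltnS prednK.
  have [L L0 rL] := @poly_leading_bound R r 0%N (ltac:(by [])).
  have slope v : `|v| <= 1 -> v != 0 ->
      `|(W + v) ^+ k - W ^+ k| = lam i * `|v / theta| ^+ k ->
      `|r.[0]| <= (L + lam i * theta^-1 ^+ k) * `|v|.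
    move=> v1 v0 E.
    have rv : `|r.[v]| <= lam i * theta^-1 ^+ k * `|v|.
      rewrite -(ler_pM2l (_ : 0 < `|v|)) ?normr_gt0 // -normrM rE.
      have -> : v * (\sum_(l < k) (W + v) ^+ (k.-1 - l) * W ^+ l) = (W + v) ^+ k - W ^+ k.
        by rewrite subrXX [W + v - W]addrAC subrr add0r.
      rewrite E normrM exprMn normfV (gtr0_norm theta_gt0).
      have -> : `|v| * (lam i * theta^-1 ^+ k * `|v|) = lam i * (`|v| ^+ 2 * theta^-1 ^+ k).
        by ring.
      have /andP[l0 _] := lam01 i.
      rewrite ler_wpM2l // ler_wpM2r ?exprn_ge0 ?invr_ge0 ?(ltW theta_gt0) //.
      exact: ler_wiXn2l.
    have := rL v v1; rewrite -horner_coef0 expr0 mulr1 expr1 => rv0.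
    have := ler_normB r.[v] (r.[v] - r.[0]); rewrite subKr mulrDl; lra.
  suff : `|r.[0]| <= 0.
    rewrite normr_le0 r0 mulf_eq0 pnatr_eq0 eqn0Ngt k_gt0 /= expf_eq0 => /andP[_].
    by rewrite subr_eq0 => /eqP.
  have half01 : 0 <= (2^-1 : R) < 1 by lra.
  apply: (le_of_geometric_error (K := (L + lam i * theta^-1 ^+ k) * (theta * 2^-1)) half01) => n.
  rewrite add0r -!mulrA -exprS.
  have [t [t_gt0 t_half tE]] : exists t : R, [/\ 0 < t, t <= 2^-1 & 2^-1 ^+ n.+1 = t].
    exists (2^-1 ^+ n.+1); split => //.
    by rewrite exprS ler_piMr ?invr_ge0 // exprn_ile1 ?invr_ge0 // ltW //; case/andP: half01.
  have [x x01 xz] := nearby_point z01 t_gt0 t_half.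
  have -> : theta * 2^-1 ^+ n.+1 = `|theta * (x - z)|.
    by rewrite tE normrM xz gtr0_norm.
  apply: slope.
  - by rewrite normrM xz gtr0_norm // mulr_ile1 ?ltW //; lra.
  - by rewrite -normr_gt0 normrM xz gtr0_norm // mulr_gt0.
  - have := D_scale i x z x01 z01.
    rewrite /D subrr expr0n -[k == 0%N]negbK -lt0n k_gt0 subr0 normrX.
    rewrite (_ : theta * (x - z) / theta = x - z); last first.
      by rewrite mulrAC divff ?mul1r // gt_eqF.
    move=> <-; congr (`|_ ^+ k - _ ^+ k|).
    by rewrite /W !phi_unif; ring.
have m0 : (0 < m)%N := num_pieces_gt0 c_sum.
have m1 : (m.-1 < m)%N by rewrite prednK.
(* The first map fixes only 0, and the last one sends 0 to 1 - theta. *)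
have := fixed (Ordinal m0); have := fixed (Ordinal m1); rewrite !phi_unif /= knot0.
have : knot c m.-1 + theta = 1.
  have := knotS c (Ordinal m1); rewrite /= prednK // knot_max c_sum c_unif.
  by move=> <-.
move: theta_gt0 theta_lt1 => h1 h2 h3 h4 h5.
have z0 : (theta - 1) * z = 0 by lra.
have : z = 0.
  by move/eqP: z0; rewrite mulf_eq0 subr_eq0 lt_eqF //= => /eqP.
move=> zE; rewrite zE in h4; lra.
Qed.

End Monomial.

Lemma nd_holder_of_holder_uniform alpha t0 : 0 < alpha -> 0 < t0 < 1 ->
  holder_at u alpha t0 -> nd_holder_at u alpha t0.
Proof.
move=> a0 t01 [C [P [Pdeg uP]]].
have P0 : forall k, (0 < k)%N -> forall i, (P i)`_k = 0.
  (* Coefficients of degree at least alpha vanish by the degree bound. Below alpha, the vanishing of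
     the lower ones leaves a single monomial with a remainder of order [Num.min alpha k.+1%:R],
     above k. *)
  elim/ltn_ind => k IH k0.
  have [ka|ak] := ltrP k%:R alpha; last first.
    move=> i; apply: nth_default; rewrite -[k]prednK // -ltnS prednK // ltnS.
    have := lt_le_trans (Pdeg i) ak; rewrite ltr_nat.
    by case: (size (P i)) => [|n] //=.
  have [|M hM] := holder_at_truncate (k := k) a0 t01 uP.
    by move=> i j /andP[j0 jk]; exact: IH.
  have km : k%:R < Num.min alpha k.+1%:R by rewrite lt_min ka ltr_nat /=.
  have := monomial_vanishes k0 km t01 hM.
  move=> /rowP h i; have := h i; rewrite !mxE coefB coefC.
  by rewrite eqn0Ngt k0 subr0.
have ut0 := holder_at_center a0 t01 uP.
exists C => t t1; have := uP t t1; rewrite (_ : \row_i (P i).[t - t0] = u t0) //.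
rewrite ut0; apply/rowP => i; rewrite !mxE.
have -> : P i = ((P i)`_0)%:P.
  by apply/polyP => -[|j]; rewrite coefC //= P0.
by rewrite !hornerC.
Qed.

Lemma holder_exponent_uniform t : 0 < t < 1 -> holder_exponent u t = nd_holder_exponent u t.
Proof.
move=> t01; congr ereal_sup; apply/seteqP; split => _ [a [a0 ha] <-]; exists a => //.
  by split => //; exact: nd_holder_of_holder_uniform.
by split => //; exact: holder_of_nd_holder.
Qed.

End NoPolynomialPart.

Theorem mainTheorem8 (R : realType) (d m : nat) (c lam : 'I_m -> R)
    (eps : 'I_m -> bool) (f : R -> 'rV[R]_d) :
  of_form_star c lam eps f ->
  nondegenerate_params c lam ->
  exists s : R,
    [/\ 1 <= s,
        \sum_i lam i `^ s = 1,
        forall s' : R, 0 < s' -> \sum_i lam i `^ s' = 1 -> s' = s &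
        exists g : R -> R,
          [/\ is_time_change c lam eps s g,
              forall g' : R -> R, is_time_change c lam eps s g' ->
                forall t : R, 0 <= t <= 1 -> g' t = g t &
              let h := fun y : R => f (left_inv g y) in
              let c_h := fun i => lam (nonzero_index (lam := lam) i) `^ s in
              let lam_h := fun i => lam (nonzero_index (lam := lam) i) in
              [/\ (* (a) *)
                  ((forall t : R, 0 < t < 1 ->
                      nd_holder_exponent (vec1 g) t
                        = (s%:E * nd_holder_exponent f t)%E) /\
                   (forall alpha : R,
                      hausdorff_dim (nd_holder_level (vec1 g) alpha)
                        = hausdorff_dim (nd_holder_level f (alpha / s)))) /\
                  ((forall i, c i = m%:R^-1) -> (forall i, eps i = false) ->
                   nondegenerate_params c (fun i => lam i `^ s) ->
                   (forall t : R, 0 < t < 1 ->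
                      holder_exponent (vec1 g) t
                        = (s%:E * holder_exponent f t)%E) /\
                   (forall alpha : R,
                      hausdorff_dim (holder_level (vec1 g) alpha)
                        = hausdorff_dim (holder_level f (alpha / s)))),
                  (* (b) *)
                  forall t : R, 0 <= t <= 1 -> f t = h (g t),
                  (* (c) *)
                  exists eps_h, of_form_star c_h lam_h eps_h h &
                  (* (d) *)
                  nondegenerate_params c_h lam_h ->
                  forall t : R, 0 < t < 1 -> holder_exponent h t = (s^-1)%:E]]].
Proof.
move=> [S fS] nondeg.
have c_gt0 := fs_c_gt0 fS; have c_sum := fs_c_sum fS.
have lam01 i : 0 <= lam i < 1 := form_lam_itv i fS.
have [s [s1 s_sum s_uniq]] := dimension_exponent fS.
have s0 : 0 < s := lt_le_trans ltr01 s1.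
have p01 := powR_ratio_itv lam01 s0.
have [g gT] := time_change_exists eps c_gt0 c_sum p01 s_sum.
have gS := is_time_change_of_time_change (fs_num fS) c_gt0 c_sum lam01 s0 s_sum gT.
exists s; split => //; exists g; split => //.
  move=> g' g'S t t01.
  have g'T := time_change_of_is_time_change c_gt0 c_sum g'S.
  exact: time_change_unique c_gt0 c_sum p01 _ _ _ gT g'T t01.
have nd t : 0 < t < 1 -> nd_holder_exponent (vec1 g) t = (s%:E * nd_holder_exponent f t)%E.
  exact: (nd_exponent_time_change fS s1 gT).
split.
- split.
    split => // alpha; congr hausdorff_dim; apply/seteqP; split => t [t01 E]; split => //.
      by apply/(ereal_rescale_eq _ _ s0); rewrite -nd.
    by rewrite nd //; apply/(ereal_rescale_eq _ _ s0).
  move=> c_unif eps0 nondeg_s; have [_ _ _ _ [Sg gSg]] := gS.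
  (* Nondegeneracy of f and of g excludes Taylor terms for both, so the relation transfers from the
     nondirectional exponents. *)
  have ex t : 0 < t < 1 -> holder_exponent (vec1 g) t = (s%:E * holder_exponent f t)%E.
    move=> t01; rewrite (holder_exponent_uniform gSg c_unif eps0 nondeg_s t01).
    by rewrite (holder_exponent_uniform fS c_unif eps0 nondeg t01) nd.
  split => // alpha; congr hausdorff_dim; apply/seteqP; split => t [t01 E]; split => //.
    by apply/(ereal_rescale_eq _ _ s0); rewrite -ex.
  by rewrite ex //; apply/(ereal_rescale_eq _ _ s0).
- exact: (left_inv_factor fS s1 s_sum gT).
- by eexists; eexists; exact: (factor_form fS s1 s_sum gT).
- move=> nondeg_h t t01; apply: (factor_exponent fS s1 s_sum gT) => //.
  (* If s = 1, the lengths and the ratios of h agree. *)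
  rewrite lt_neqAle s1 andbT; apply/eqP => s1E; apply: nondeg_h => i.
  by rewrite -s1E powRr1 // ltW // nonzero_index_gt0.
Qed.
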